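(* Let $p$ be fixed and consider the linear model $y_i=\mathbf{x}_i^T\mathbf{b}^*+\epsilon_i$, $i=1,\dots,n$, with $\mathbf{x}_i\in\mathbb{R}^p$, $\mathbf{b}^*\in\mathbb{R}^p$ and $\epsilon_1,\dots,\epsilon_n$ i.i.d. with mean $0$ and variance $\sigma^2$. Let $\mathbf{y}=(y_1,\dots,y_n)^T$, $\mathbf{X}=[\mathbf{x}_1,\dots,\mathbf{x}_n]^T$, and assume $\mathbf{X}^T\mathbf{X}/n\to\mathbf{C}$ for a positive definite matrix $\mathbf{C}$. Define \[ \tilde{\mathbf{b}}_n=\arg\min_{\mathbf{b}}\ \|\mathbf{y}-\mathbf{X}\mathbf{b}\|_2^2+\frac{\eta_n}{\alpha_n}\sum_{j=1}^p\Big[\sqrt{1+2\alpha_n|b_j|}-1\Big], \] with $\eta_n>0$, $\alpha_n>0$. Assume $\lim_{n\to\infty}\alpha_n=0$. If $\lim_{n\to\infty}\eta_n/\sqrt n=2c_3\in[0,\infty)$, then $\tilde{\mathbf{b}}_n\xrightarrow{p}\mathbf{b}^*$. Furthermore, if $\lim_{n\to\infty}\eta_n/\sqrt n=0$, then $\sqrt n(\tilde{\mathbf{b}}_n-\mathbf{b}^* )\xrightarrow{d}N(\mathbf{0},\sigma^2\mathbf{C}^{-1})$. *)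

(* Defs.v *)
From HB Require Import structures.
From mathcomp Require Import all_boot all_order all_algebra.
From mathcomp Require Import all_classical all_reals all_analysis.
Set Implicit Arguments. Unset Strict Implicit. Unset Printing Implicit Defensive.
Import Order.TTheory GRing.Theory Num.Theory.
Import numFieldNormedType.Exports.
Local Open Scope classical_set_scope.
Local Open Scope ring_scope.

Definition mutually_independent {d} {T : measurableType d} {R : realType}
  (P : probability T R) (X : nat -> T -> R) : Prop :=
  forall (s : seq nat) (B : nat -> set R),
    uniq s -> (forall i, measurable (B i)) ->
    P (\big[setI/setT]_(i <- s) (X i @^-1` B i)) =
    (\prod_(i <- s) P (X i @^-1` B i))%E.

Definition identically_distributed {d} {T : measurableType d} {R : realType}
  (P : probability T R) (X : nat -> T -> R) : Prop :=
  forall i (B : set R), measurable B -> P (X i @^-1` B) = P (X 0%N @^-1` B).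

Definition design {R : realType} {p : nat} (xs : nat -> 'rV[R]_p) (n : nat)
  : 'M[R]_(n, p) := \matrix_(i < n) xs i.

Definition response {d} {T : measurableType d} {R : realType} {p : nat}
  (xs : nat -> 'rV[R]_p) (bstar : 'cV[R]_p) (eps : nat -> T -> R)
  (n : nat) (w : T) : 'cV[R]_n :=
  \col_(i < n) ((xs i *m bstar) 0 0 + eps i w).

Definition penalized_obj {R : realType} {p n : nat}
  (X : 'M[R]_(n, p)) (y : 'cV[R]_n) (eta alpha : R) (b : 'cV[R]_p) : R :=
  \sum_(i < n) ((y - X *m b) i 0) ^+ 2
  + eta / alpha * \sum_(j < p) (Num.sqrt (1 + 2 * alpha * `|b j 0|) - 1).

Definition posdef {R : realType} {p : nat} (C : 'M[R]_p) : Prop :=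
  C^T = C /\ forall v : 'cV[R]_p, v != 0 -> 0 < (v^T *m C *m v) 0 0.

(* Iterated integral of F against k independent standard normal coordinates:
   gauss_iter k F = E[F(Z_0,...,Z_{k-1},0,0,...)] with Z_i iid N(0,1). *)
Fixpoint gauss_iter {R : realType} (k : nat) (F : (nat -> R) -> R) : \bar R :=
  match k with
  | 0%N => (F (fun _ => 0))%:E
  | k'.+1 => (\int[lebesgue_measure]_z
      ((normal_pdf 0 1 z)%:E *
        gauss_iter k' (fun v => F (fun i => if i == k' then z else v i))))%E
  end.

(* Expectation of f under N(0, A A^T) on R^p: E[f(A Z)], Z standard normal. *)
Definition gauss_expect {R : realType} {p : nat} (A : 'M[R]_p)
  (f : 'cV[R]_p -> R) : \bar R :=
  gauss_iter p (fun v => f (A *m \col_(i < p) v i)).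

Definition cvg_dist_normal {d} {T : measurableType d} {R : realType} {p : nat}
  (P : probability T R) (Z : nat -> T -> 'cV[R]_p) (Sigma : 'M[R]_p) : Prop :=
  forall A : 'M[R]_p, A *m A^T = Sigma ->
  forall f : 'cV[R]_p -> R, continuous f -> (exists M : R, forall v, `|f v| <= M) ->
    (fun n => 'E_P[f \o Z n])%E @ \oo --> gauss_expect A f.

Definition cvg_prob {d} {T : measurableType d} {R : realType} {p : nat}
  (P : probability T R) (Z : nat -> T -> 'cV[R]_p) (c : 'cV[R]_p) : Prop :=
  forall e : R, 0 < e ->
    (fun n => P [set w | e < `|Z n w - c|]) @ \oo --> 0%E.

(* Main.v *)
Require Import Defs.
From HB Require Import structures.
From mathcomp Require Import all_boot all_order all_algebra.
From mathcomp Require Import all_classical all_reals all_analysis.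
From mathcomp Require Import measurable_realfun ring lra.
Set Implicit Arguments.
Unset Strict Implicit.
Unset Printing Implicit Defensive.
Import Order.TTheory GRing.Theory Num.Theory.
Import numFieldNormedType.Exports.
Local Open Scope classical_set_scope.
Local Open Scope ring_scope.

(** Writing [Z_n = sqrt n (b_n - beta)] for the scaled error of the penalized estimator and [W_n]
    for that of ordinary least squares, Pythagoras in the column space of [X] bounds
    [|X (b_n - b_OLS)|^2] by the variation of the penalty.  Each term of the penalty is
    [eta]-Lipschitz, because [t |-> (sqrt (1 + 2 alpha t) - 1) / alpha] is 1-Lipschitz on
    [t >= 0], and the quadratic form of [X^T X / n] is eventually bounded below, so
    [|Z_n - W_n| <= K eta_n / sqrt n] deterministically: consistency follows from Chebyshev's
    inequality and asymptotic normality reduces to that of [W_n = sum_i a_(n,i) eps_i].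

    The latter is proved by characteristic functions in real form.  With
    [S_m = sum_(i < m) c_i eps_i], independence turns [E cos (S_m + th)] into the recursion
    [E cos (S_(m+1) + th) = E cos (S_m + th) E cos (c_m eps) + E cos (S_m + th + pi/2) E sin (c_m eps)],
    which is compared with that of the Gaussian; the Lindeberg condition is
    [max_i |x_i|^2 / n -> 0], a consequence of the convergence of [X^T X / n].

    To pass from cosines to bounded continuous [f], one approximates [f] on a box by a
    Bernstein polynomial in the variables [(1 + sin (w x_j)) / 2].  This is a trigonometric
    polynomial, and since it is an average of values of [f] it keeps the sup bound of [f] on
    the whole space, so that tightness controls the error outside the box. *)

(** Independence is given as a product formula for events, so it is first raised to products of
    bounded functions, freeing one factor at a time from being an indicator. The addition formula
    for cosine then moves each [c_i eps_i] out of the sum into such a product, and the phase [th]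
    keeps the recursion real: a sine is a cosine shifted by [pi / 2]. For the Gaussian, symmetry
    kills the sine term, so one step is multiplication by a factor in [0, 1]. Local errors therefore
    add without growing, and [o(c_i^2)] for each is enough because the [c_i^2] have a bounded sum.
    With only two moments at hand, the remainders must have the form [x^2 min(1, |x|)].

    The limit law is an iterated integral of a function of sequences; dominated convergence is
    carried through the iteration itself.

    When [eta_n / sqrt n] has a positive limit, [Z_n] and [W_n] are only a bounded distance apart.
    This disappears after division by [sqrt n], which gives consistency; the normal limit needs the
    distance itself to vanish. *)

Section TrigBounds.
Context {R : realType}.
Implicit Types x y : R.

Lemma sin_lip x y : `|sin x - sin y| <= `|x - y|.
Proof.
wlog xy : x y / x <= y => [H|].
  have [/H//|/ltW/H] := leP x y.
  by rewrite distrC (distrC y).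
move: xy; rewrite le_eqVlt => /predU1P[->|xy]; first by rewrite !subrr.
have [c _ e] := @MVT R sin cos x y xy (fun z _ => is_derive_sin z)
  (continuous_subspaceT (@continuous_sin R)).
rewrite distrC e normrM (distrC x) -[leRHS]mul1r.
by apply: ler_wpM2r => //; exact: cos_max.
Qed.

Lemma cos_lip x y : `|cos x - cos y| <= `|x - y|.
Proof.
rewrite -!sinDpihalf; apply: le_trans (sin_lip _ _) _.
by rewrite opprD addrACA subrr addr0.
Qed.

Lemma norm_sin_le x : `|sin x| <= `|x|.
Proof. by have := sin_lip x 0; rewrite sin0 !subr0. Qed.

Lemma cos_ge_sqr x : 1 - x ^+ 2 / 2 <= cos x.
Proof.
have -> : cos x = 1 - 2 * sin (x / 2) ^+ 2.
  have {1}-> : x = (x / 2) *+ 2 by rewrite -mulr_natr divfK.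
  by rewrite cos_mulr2n cos2sin2 -mulr_natl; lra.
have h : `|sin (x/2)| ^+ 2 <= `|x / 2| ^+ 2.
  by rewrite lerXn2r ?nnegrE//; exact: norm_sin_le.
rewrite !real_normK ?num_real// exprMn in h.
by lra.
Qed.

(** The mean value theorem gives one factor [z] and [cos_ge_sqr] the other two; what matters later
    is the order, not the constant. *)
Lemma sin_taylor1 x : `|sin x - x| <= `|x| ^+ 3.
Proof.
have gen (z : R) (z0 : 0 < z) : `|sin z - z| <= `|z| ^+ 3.
  pose f t : R := sin t - t.
  have df (t : R) : t \in `]0, z[ -> is_derive t 1 f (cos t - 1).
    by move=> _; exact: is_deriveB.
  have cf : {within `[0, z], continuous f}.
    apply: continuous_subspaceT => t; apply: cvgB => //.
    exact: continuous_sin.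
  have [c cz] := MVT z0 df cf.
  rewrite /f sin0 !subr0 => ->; rewrite normrM.
  have : `|cos c - 1| <= z ^+ 2.
    rewrite ler0_norm ?subr_le0 ?cos_le1//.
    have := cos_ge_sqr c.
    move: cz; rewrite in_itv/= => /andP[c0 cz].
    have : c ^+ 2 <= z ^+ 2 by rewrite lerXn2r ?nnegrE ?ltW// (lt_trans c0).
    have := sqr_ge0 z; lra.
  move=> h; rewrite exprSr (gtr0_norm z0); apply: ler_wpM2r => //; exact: ltW.
case: (ltgtP x 0) => [x0|/gen//|->]; last first.
  by rewrite sin0 subrr normr0 expr0n.
have := @gen (- x); rewrite oppr_gt0 => /(_ x0).
by rewrite sinN -opprD !normrN.
Qed.

Lemma cos_taylor2 x : `|cos x - 1 + x ^+ 2 / 2| <= `|x| ^+ 3 * `|x|.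
Proof.
have gen (z : R) (z0 : 0 < z) : `|cos z - 1 + z ^+ 2 / 2| <= `|z| ^+ 3 * `|z|.
  pose f t : R := cos t - 1 + t ^+ 2 / 2.
  have df (t : R) : t \in `]0, z[ -> is_derive t 1 f (- sin t + t).
    move=> _; rewrite /f.
    apply: is_derive_eq.
    by rewrite !scaler0 /GRing.scale/=; lra.
  have cf : {within `[0, z], continuous f}.
    apply: continuous_subspaceT => t; apply: cvgD.
      apply: cvgB; [exact: continuous_cos|exact: cvg_cst].
    by apply: cvgM; [exact: exprn_continuous|exact: cvg_cst].
  have [c cz] := MVT z0 df cf.
  rewrite /f cos0 expr0n/= mul0r addr0 subrr !subr0 => ->.
  rewrite normrM (gtr0_norm z0) addrC distrC.
  apply: ler_wpM2r; first exact: ltW.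
  apply: le_trans (sin_taylor1 _) _.
  move: cz; rewrite in_itv/= => /andP[c0 cz].
  by rewrite gtr0_norm// lerXn2r ?nnegrE ?ltW// (lt_trans c0).
case: (ltgtP x 0) => [x0|/gen//|->]; last first.
  by rewrite cos0 expr0n/= mul0r addr0 subrr normr0 mulr0.
have := @gen (- x); rewrite oppr_gt0 => /(_ x0).
by rewrite cosN sqrrN normrN.
Qed.

(** The cutoff suits variables with only two moments: at [c X] the bound is
    [2 c^2 X^2 min(1, |c X|)], which is integrable and has mean [o(c^2)]. *)
Lemma sin_remainder x : `|sin x - x| <= 2 * x ^+ 2 * Num.min 1 `|x|.
Proof.
rewrite -real_normK ?num_real//.
have [x1|x1] := leP 1 `|x|.
  rewrite mulr1; apply: le_trans (ler_normB _ _) _.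
  have := norm_sin_le x; have : `|x| * 1 <= `|x| * `|x| by apply: ler_wpM2l.
  by rewrite expr2; lra.
apply: le_trans (sin_taylor1 x) _.
rewrite exprSr; apply: ler_wpM2r => //.
by have := sqr_ge0 `|x|; lra.
Qed.

Lemma cos_remainder x : `|cos x - 1 + x ^+ 2 / 2| <= 2 * x ^+ 2 * Num.min 1 `|x|.
Proof.
have [x1|x1] := leP 1 `|x|.
  rewrite mulr1 ger0_norm; last by have := cos_ge_sqr x; lra.
  have := cos_le1 x; have : 0 <= x ^+ 2 by exact: sqr_ge0.
  lra.
apply: le_trans (cos_taylor2 x) _.
rewrite -(real_normK (num_real x)).
have h : `|x| ^+ 3 * `|x| <= `|x| ^+ 3 * 1 by apply: ler_wpM2l; [exact: exprn_ge0|exact: ltW].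
apply: le_trans h _; rewrite mulr1 exprSr; apply: ler_wpM2r => //.
by have := sqr_ge0 `|x|; lra.
Qed.

(** With half-difference [h] and midpoint [m], the difference of sines is [2 sin h cos m]. Both
    [m - h] and [m + h] lie in the interval, so [|m| + h <= pi / 2] and hence [cos m >= sin h]. The
    square reflects the flatness of sine at the two ends. *)
Lemma sin_separated x y (z : R) :
  - (pi / 2) <= x <= pi / 2 -> - (pi / 2) <= y <= pi / 2 ->
  0 < z <= `|x - y| -> 2 * sin (z / 2) ^+ 2 <= `|sin x - sin y|.
Proof.
wlog xy : x y / y <= x => [H|] hx hy.
  have [/H|/ltW/H] := leP y x; first exact.
  by rewrite (distrC y) (distrC (sin y)); exact.
rewrite (ger0_norm (x := x - y)) ?subr_ge0// => /andP[z0 zxy].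
move: hx hy => /andP[hx1 hx2] /andP[hy1 hy2].
have pi0 := @pi_gt0 R.
set h := (x - y) / 2; set m := (x + y) / 2.
have -> : x = m + h by rewrite /m /h; lra.
have -> : y = m - h by rewrite /m /h; lra.
have -> : sin (m + h) - sin (m - h) = 2 * (sin h * cos m).
  by rewrite sinD sinB; ring.
have zh : sin (z / 2) <= sin h.
  have [->|zh] := eqVneq (z / 2) h; first by [].
  apply/ltW; rewrite ltr_sin ?in_itv/=.
  - by rewrite lt_neqAle zh /= /h; lra.
  - by apply/andP; split; lra.
  - by rewrite /h; apply/andP; split; lra.
have z20 : 0 < sin (z / 2) by rewrite sin_gt0_pi//; apply/andP; split; lra.
have hm : sin h <= cos m.
  have [m0|m0] := leP 0 m.
    rewrite -cosN -sinDpihalf.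
    have [->|hm] := eqVneq h (- m + pi / 2); first by [].
    apply/ltW; rewrite ltr_sin ?in_itv/=.
    - by rewrite lt_neqAle hm /= /h /m; lra.
    - by rewrite /h; apply/andP; split; lra.
    - by move: m0; rewrite /m => m0; apply/andP; split; lra.
  rewrite -sinDpihalf.
  have [->|hm] := eqVneq h (m + pi / 2); first by [].
  apply/ltW; rewrite ltr_sin ?in_itv/=.
  - by rewrite lt_neqAle hm /= /h /m; lra.
  - by rewrite /h; apply/andP; split; lra.
  - by move: m0; rewrite /m => m0; apply/andP; split; lra.
have zz := ltW z20.
rewrite ger0_norm; last by rewrite !mulr_ge0//; lra.
by rewrite ler_wpM2l// expr2; apply: ler_pM => //; lra.
Qed.
End TrigBounds.

(** * Gaussian integrals *)

Section GaussianCF.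
Context {R : realType}.
Notation mu := (@lebesgue_measure R).
Notation phi := (@normal_pdf R 0 1).

Lemma integrable_phiM (h : R -> R) (M : R) : measurable_fun setT h ->
  (forall z, `|h z| <= M) -> mu.-integrable setT (EFin \o (fun z => phi z * h z)).
Proof.
move=> mh bh.
apply: (@integrableMl _ _ _ mu setT measurableT (EFin \o phi) h) => //.
- exact: integrable_normal_pdf.
- by exists M; split; [exact: num_real|move=> x Mx z _; exact: le_trans (bh z) (ltW Mx)].
Qed.

Lemma phiE (z : R) : phi z = phi 0 * expR (- z ^+ 2 / 2).
Proof.
rewrite normal_pdfE ?oner_neq0// /normal_fun !subr0 expr0n/= oppr0 mul0r expR0 mulr1.
by rewrite expr1n.
Qed.

(** The normal density of variance 2 dominates, up to normalising constants:
    [|z| <= 1 + z^2 / 4 <= exp (z^2 / 4)], and the exponent [- z^2 / 2] becomes [- z^2 / 4]. *)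
Lemma integrable_phi_id : mu.-integrable setT (EFin \o (fun z => phi z * `|z|)).
Proof.
pose s : R := Num.sqrt 2.
have s0 : s != 0 by rewrite gt_eqF// sqrtr_gt0.
have i2 := integrable_normal_pdf 0 s.
pose K : R := phi 0 * (normal_peak s)^-1.
have K0 : 0 <= K by rewrite mulr_ge0 ?normal_pdf_ge0 ?invr_ge0 ?normal_peak_ge0.
apply: le_integrable (integrableZl measurableT K i2) => //.
  apply/measurable_EFinP; apply: measurable_funM; first exact: measurable_normal_pdf.
  exact: normr_measurable.
move=> z _ /=; rewrite lee_fin !normrM normr_id.
rewrite (ger0_norm (normal_pdf_ge0 0 1 z)) (ger0_norm (normal_pdf_ge0 0 1 0)).
rewrite (ger0_norm (normal_pdf_ge0 0 s z)) ger0_norm ?invr_ge0 ?normal_peak_ge0//.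
rewrite phiE (normal_pdfE _ s0) /normal_fun subr0.
have p0 : 0 < normal_peak s by rewrite normal_peak_gt0.
rewrite -!mulrA ler_wpM2l ?normal_pdf_ge0//.
rewrite mulKf ?gt_eqF// sqr_sqrtr//.
have -> : - z ^+ 2 / (2 *+ 2) = - z ^+ 2 / 2 + z ^+ 2 / 4 by rewrite -mulr_natr; field.
rewrite expRD ler_wpM2l ?expR_ge0//.
apply: le_trans _ (expR_ge1Dx _).
rewrite -real_normK ?num_real//.
suff h (x : R) : x <= 1 + x ^+ 2 / 4 by exact: h.
by have := sqr_ge0 (x / 2 - 1); lra.
Qed.

Lemma measurable_trig (f : R -> R) (t th : R) : continuous f ->
  measurable_fun setT (fun z : R => f (t * z + th)).
Proof.
move=> cf; apply: (measurableT_comp (continuous_measurable_fun cf)).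
by apply: measurable_funD => //; exact: measurable_funM.
Qed.

Lemma is_derive_phi (z : R) : is_derive z 1 (phi : R -> R) (- z * phi z).
Proof.
have -> : (phi : R -> R) = (fun z => phi 0 * expR (- z ^+ 2 / 2)).
  by apply/funext => y; exact: phiE.
apply: is_derive_eq.
rewrite !scaler0 /GRing.scale/=.
by field.
Qed.

Lemma is_derive_affine_comp (f f' : R -> R) (a b z : R) :
  (forall x : R, is_derive x 1 f (f' x)) ->
  is_derive z 1 (fun z : R => f (a * z + b)) (a * f' (a * z + b)).
Proof.
move=> df.
have dg : is_derive z 1 (fun z : R => a * z + b) a.
  have d1 := is_deriveD (is_deriveZ a (is_derive_id z (1:R))) (is_derive_cst b z (1:R)).
  by apply: is_derive_eq; rewrite /GRing.scale/= mulr1 addr0.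
have h : is_derive z 1 (f \o (fun z:R => a*z+b)) (f' (a*z+b) * a).
  apply: is_derive1_comp.
rewrite [a * f' _]mulrC; exact: h.
Qed.

(** The integrand is the derivative of [phi z * sin (t z + th)], which vanishes at infinity. This is
    Stein's identity [E[Z sin (t Z + th)] = t E[cos (t Z + th)]]. *)
Lemma gauss_parts (t th : R) :
  \int[mu]_z (phi z * (t * cos (t * z + th) - z * sin (t * z + th))) = 0.
Proof.
pose F z : R := phi z * sin (t * z + th).
pose f z : R := phi z * (t * cos (t * z + th) - z * sin (t * z + th)).
have dF (z : R) : is_derive z 1 F (f z).
  have d1 := is_derive_phi z.
  have d2 : is_derive z 1 (fun z : R => sin (t * z + th)) (t * cos (t * z + th)).
    exact: is_derive_affine_comp.
  by apply: is_derive_eq; rewrite /f /GRing.scale/=; ring.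
have cphi : continuous (phi : R -> R) by apply: continuous_normal_pdf; rewrite oner_neq0.
have caff : continuous (fun z : R => t * z + th).
  by move=> z; apply: cvgD; [apply: cvgM => //; exact: cvg_cst|exact: cvg_cst].
have cs : continuous (fun z : R => sin (t * z + th)).
  by move=> z; apply: continuous_comp; [exact: caff|exact: continuous_sin].
have cc : continuous (fun z : R => cos (t * z + th)).
  by move=> z; apply: continuous_comp; [exact: caff|exact: continuous_cos].
have cf : continuous f.
  move=> z; apply: cvgM; first exact: cphi.
  apply: cvgB; apply: cvgM; [exact: cvg_cst|exact: cc|exact: cvg_id|exact: cs].
have mf : measurable_fun setT f by exact: continuous_measurable_fun.
have intf : mu.-integrable setT (EFin \o f).
  have i1 := @integrable_phiM (cst `|t|) `|t| (measurable_cst _) (fun _ => eq_ind_r (fun x => x <= `|t|) (lexx _) (normr_id _)).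
  apply: le_integrable (integrableD measurableT i1 integrable_phi_id) => //.
    exact/measurable_EFinP.
  move=> z _ /=; rewrite lee_fin /f.
  rewrite [leRHS]ger0_norm ?addr_ge0 ?mulr_ge0 ?normal_pdf_ge0// -mulrDr normrM.
  rewrite ger0_norm ?normal_pdf_ge0// ler_wpM2l ?normal_pdf_ge0//.
  apply: le_trans (ler_normB _ _) _; rewrite !normrM; apply: lerD.
    by rewrite ler_piMr// cos_max.
  by rewrite ler_piMr// sin_max.
have FTC (n : nat) : (\int[mu]_(z in `[(- n.+1%:R)%R, n.+1%:R%R]) (f z)%:E = (F n.+1%:R - F (- n.+1%:R))%:E)%E.
  have FE : F^`()%classic = f by apply/funext => z; rewrite derive1E; exact: derive_val.
  have cF : continuous F by move=> z; apply: cvgM; [exact: cphi|exact: cs].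
  rewrite (@continuous_FTC2 _ f F)//.
  - by rewrite (@lt_trans _ _ 0) ?oppr_lt0 ?ltr0n.
  - exact: continuous_subspaceT.
  - split; first by move=> x _; exact: ex_derive.
    + exact/cvg_at_right_filter/cF.
    + exact/cvg_at_left_filter/cF.
  - by move=> x _; rewrite FE.
(* At [|z| = n + 1] one has [exp (z^2 / 2) >= 1 + z^2 / 2 >= (n + 1) / 2], so each boundary term is
   at most [2 phi 0 / (n + 1)]. *)
have lim0 : (fun n : nat => F n.+1%:R - F (- n.+1%:R)) @ \oo --> 0.
  have bF (z : R) n : z ^+ 2 = n.+1%:R ^+ 2 -> `|F z| <= (2 * phi 0) * harmonic n.
    move=> zn; rewrite /F normrM ger0_norm ?normal_pdf_ge0//.
    apply: (@le_trans _ _ (phi z)); first by rewrite ler_piMr ?normal_pdf_ge0// sin_max.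
    rewrite phiE (mulrC 2) -mulrA ler_wpM2l ?normal_pdf_ge0//.
    rewrite mulNr expRN zn /harmonic/=.
    have -> : 2 * n.+1%:R^-1 = (2^-1 * n.+1%:R)^-1 :> R by rewrite invfM invrK.
    rewrite lef_pV2 ?posrE ?expR_gt0 ?mulr_gt0 ?invr_gt0//.
    apply: le_trans _ (expR_ge1Dx _).
    have : (1 : R) <= n.+1%:R by rewrite ler1n.
    by move: (n.+1%:R : R) => x x1; rewrite expr2; nra.
  have : (fun n : nat => 2 * (2 * phi 0) * harmonic n) @ \oo --> (2 * (2 * phi 0) * 0 : R).
    by apply: cvgM; [exact: cvg_cst|exact: cvg_harmonic].
  rewrite mulr0 => h; apply: norm_cvg0.
  apply: (squeeze_cvgr _ (cvg_cst 0) h).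
  apply: nearW => n; rewrite normr_ge0/=.
  apply: le_trans (ler_normB _ _) _.
  apply: le_trans (lerD (bF _ n erefl) (bF _ n (sqrrN _))) _.
  by rewrite -[leRHS]mulrA [leRHS]mulr_natl mulr2n.
pose A n : set R := `[(- n.+1%:R)%R, n.+1%:R%R]%classic.
have mA n : measurable (A n) by exact: measurable_itv.
have DC : (fun n => \int[mu]_z ((EFin \o f) \_ (A n)) z)%E @ \oo --> (\int[mu]_z (f z)%:E)%E.
  apply: (@dominated_cvg _ _ _ mu setT measurableT _ _ (fun z => `|(f z)%:E|%E)) => //.
  - by move=> n; apply: (measurable_restrictT _ (mA n)).1; apply: measurable_funTS; exact/measurable_EFinP.
  - move=> z _; apply: cvg_near_cst.
    near=> n; rewrite patchE ifT// inE /A/= in_itv/= -ler_norml.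
    apply: (@le_trans _ _ n%:R); last by rewrite ler_nat.
    by near: n; exact: nbhs_infty_ger.
  - exact: integrable_abse.
  - by move=> n z _; rewrite patchE; case: ifP => // _; rewrite abse0 abse_ge0.
have : (\int[mu]_z (f z)%:E = 0)%E.
  apply: (cvg_unique _ DC) => //.
  have -> : (fun n => \int[mu]_z ((EFin \o f) \_ (A n)) z)%E = (fun n : nat => (F n.+1%:R - F (- n.+1%:R))%:E).
    by apply/funext => n; rewrite -FTC -integral_mkcond.
  by apply: cvg_EFin; [exact: nearW|].
by rewrite /Rintegral /f => ->.
Unshelve. all: by end_near.
Qed.

Definition gcos (th t : R) : R := \int[mu]_z (phi z * cos (t * z + th)).

(** Differentiation under the integral, dominated by [phi z * |z|], gives [- E[Z sin (t Z + th)]];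
    [gauss_parts] closes this into the linear equation [g' = - t g]. *)
Lemma is_derive_gcos (th t : R) : is_derive t 1 (gcos th) (- t * gcos th t).
Proof.
pose f s z : R := phi z * cos (s * z + th).
have intf (s : R) : mu.-integrable setT (EFin \o f s).
  apply: (@integrable_phiM _ 1); last by move=> z; exact: cos_max.
  by apply: measurable_trig; exact: continuous_cos.
have df (s z : R) : is_derive s 1 (f ^~ z) (- (phi z * (z * sin (s * z + th)))).
  have d0 : is_derive s 1 (fun s : R => cos (s * z + th)) (z * - sin (z * s + th)).
    under eq_fun do rewrite mulrC.
    exact: (@is_derive_affine_comp cos (fun x => - sin x)).
  have d1 := is_deriveZ (phi z) d0.
  by apply: is_derive_eq; rewrite /GRing.scale/= (mulrC z s); ring.
have d1E (s z : R) : partial1of2 f s z = - (phi z * (z * sin (s * z + th))).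
  by rewrite partial1of2E; exact: derive_val.
have It : `]t - 1, t + 1[%classic t by rewrite /= in_itv/=; apply/andP; split; lra.
have G0 z : 0 <= phi z * `|z| by rewrite mulr_ge0// normal_pdf_ge0.
have bd (s z : R) : `]t - 1, t + 1[%classic s -> setT z -> `|partial1of2 f s z| <= phi z * `|z|.
  move=> _ _; rewrite d1E normrN normrM ger0_norm ?normal_pdf_ge0//.
  by rewrite ler_wpM2l ?normal_pdf_ge0// normrM ler_piMr// sin_max.
have dd (s z : R) : `]t - 1, t + 1[%classic s -> setT z -> derivable (f ^~ z) s 1.
  by move=> _ _; exact: ex_derive.
have h1 := differentiation_under_integral measurableT It (fun s _ => intf s) dd G0 integrable_phi_id bd.
have h2 := derivable_under_integral measurableT It (fun s _ => intf s) dd G0 integrable_phi_id bd.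
apply: DeriveDef; first exact: h2.
rewrite -derive1E h1.
have i1 : mu.-integrable setT (EFin \o (fun z => t * (phi z * cos (t * z + th)))).
  exact: (integrableZl measurableT t (intf t)).
have i2 : mu.-integrable setT (EFin \o (fun z => phi z * (z * sin (t * z + th)))).
  apply: le_integrable integrable_phi_id => //.
    apply/measurable_EFinP; apply: measurable_funM; first exact: measurable_normal_pdf.
    by apply: measurable_funM => //; apply: measurable_trig; exact: continuous_sin.
  move=> z _ /=; rewrite lee_fin normrM [leRHS]ger0_norm// ger0_norm ?normal_pdf_ge0//.
  by rewrite ler_wpM2l ?normal_pdf_ge0// normrM ler_piMr// sin_max.
have := gauss_parts t th.
have -> : (fun z => phi z * (t * cos (t * z + th) - z * sin (t * z + th))) =
    (fun z => t * (phi z * cos (t * z + th)) - phi z * (z * sin (t * z + th))).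
  by apply/funext => z; ring.
rewrite RintegralB// (RintegralZl _ measurableT (intf t)) => /eqP; rewrite subr_eq0 => /eqP e.
rewrite mulNr /gcos e.
under eq_Rintegral do rewrite d1E -mulN1r.
by rewrite RintegralZl// mulN1r.
Qed.

Lemma gcosE (th t : R) : gcos th t = expR (- t ^+ 2 / 2) * cos th.
Proof.
(* Integrating factor of [g' = - t g]. *)
pose K s : R := expR (s ^+ 2 / 2) * gcos th s.
have dK (s : R) : is_derive s 1 K 0.
  have d1 := is_derive_gcos th s.
  have d2 : is_derive s 1 (fun s : R => expR (s ^+ 2 / 2)) (s * expR (s ^+ 2 / 2)).
    by apply: is_derive_eq; rewrite !scaler0 /GRing.scale/=; field.
  by apply: is_derive_eq; rewrite /GRing.scale/=; ring.
have : K t = K 0 by exact: is_derive_0_is_cst.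
rewrite /K expr0n/= mul0r expR0 mul1r => e.
have -> : gcos th t = expR (- t ^+ 2 / 2) * (expR (t ^+ 2 / 2) * gcos th t).
  by rewrite mulrA -expRD mulNr addNr expR0 mul1r.
rewrite e; congr (_ * _); rewrite /gcos.
under eq_Rintegral do rewrite mul0r add0r.
rewrite RintegralZr//; last exact: integrable_normal_pdf.
by rewrite /Rintegral integral_normal_pdf mul1r.
Qed.

End GaussianCF.

(** * Iterated Gaussian integrals: dominated convergence, linearity, cosines *)

Section GaussIter.
Context {R : realType}.
Notation mu := (@lebesgue_measure R).
Notation phi := (@normal_pdf R 0 1).
Implicit Types (F G : (nat -> R) -> R) (M N z : R).

(** Continuity along coordinatewise convergent sequences: exactly what dominated convergence
    consumes, and stable under fixing a coordinate. *)
Definition seq_continuous F := forall (v_ : nat -> nat -> R) (v : nat -> R),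
  (forall i, v_ n i @[n --> \oo] --> v i) -> F (v_ n) @[n --> \oo] --> F v.

Definition upd (k : nat) (z : R) (v : nat -> R) : nat -> R :=
  fun i => if i == k then z else v i.

Lemma seq_continuous_upd F k z : seq_continuous F -> seq_continuous (F \o upd k z).
Proof.
move=> cF v_ v vv; apply: cF => i; rewrite /upd.
by case: ifP => _; [exact: cvg_cst|exact: vv].
Qed.

Definition gauss_real k F : R := fine (gauss_iter k F).

Lemma gauss_iterS k F :
  (forall z, gauss_iter k (F \o upd k z) \is a fin_num) ->
  gauss_iter k.+1 F = (\int[mu]_z (phi z * gauss_real k (F \o upd k z))%:E)%E.
Proof. by move=> h /=; apply: eq_integral => z _; rewrite EFinM fineK. Qed.

(** The bound and the convergence theorem must share one induction. At [k + 1] the inner integral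
    has to be measurable in [z]; this follows from its continuity, which is the convergence
    statement at [k]. *)
Lemma gauss_iter_dominated k :
  (forall F M, seq_continuous F -> (forall v, `|F v| <= M) ->
     gauss_iter k F \is a fin_num /\ `|gauss_real k F| <= M) /\
  (forall (F_ : nat -> (nat -> R) -> R) F M,
     (forall n, seq_continuous (F_ n)) -> seq_continuous F ->
     (forall n v, `|F_ n v| <= M) ->
     (forall v, F_ n v @[n --> \oo] --> F v) ->
     gauss_real k (F_ n) @[n --> \oo] --> gauss_real k F).
Proof.
elim: k => [|k [IH1 IH2]].
  by split => [F M cF bF|F_ F M cF_ cF bF FF]; [split => //; exact: bF|exact: FF].
have cgi F M : seq_continuous F -> (forall v, `|F v| <= M) ->
    measurable_fun setT (fun z => gauss_real k (F \o upd k z)).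
  move=> cF bF; apply: continuous_measurable_fun => z.
  apply/(@cvg_nbhsP _ R^o) => u uz.
  apply: (IH2 _ _ M) => [n||n v|v].
  - exact: seq_continuous_upd.
  - exact: seq_continuous_upd.
  - exact: bF.
  - by apply: cF => i; rewrite /upd; case: ifP => _ //; exact: cvg_cst.
have fin F M z : seq_continuous F -> (forall v, `|F v| <= M) ->
    gauss_iter k (F \o upd k z) \is a fin_num /\ `|gauss_real k (F \o upd k z)| <= M.
  by move=> cF bF; apply: IH1 => [|v]; [exact: seq_continuous_upd|exact: bF].
have int F M : seq_continuous F -> (forall v, `|F v| <= M) ->
    mu.-integrable setT (EFin \o (fun z => phi z * gauss_real k (F \o upd k z))).
  move=> cF bF; apply: (@integrable_phiM _ _ M); first exact: cgi cF bF.
  by move=> z; exact: (fin _ _ z cF bF).2.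
split=> [F M cF bF|F_ F M cF_ cF bF FF].
  have E := @gauss_iterS k F (fun z => (fin _ _ z cF bF).1).
  have i1 := int _ _ cF bF.
  split; first by rewrite E; exact: (integrable_fin_num measurableT i1).
  rewrite /gauss_real E -/(Rintegral mu setT _).
  apply: le_trans (le_normr_Rintegral measurableT i1) _.
  have i2 : mu.-integrable setT (EFin \o (fun z => phi z * M)).
    by apply: (@integrable_phiM _ _ `|M|).
  apply: le_trans (le_Rintegral measurableT (integrable_norm i1) i2 _) _ => [z _ /=|].
    rewrite normrM ger0_norm ?normal_pdf_ge0// ler_wpM2l ?normal_pdf_ge0//.
    exact: (fin _ _ z cF bF).2.
  rewrite RintegralZr//; last exact: integrable_normal_pdf.
  by rewrite /Rintegral integral_normal_pdf mul1r.
have bF' v : `|F v| <= M.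
  apply: (ler_cvg_to (cvg_norm (FF v)) (cvg_cst M)).
  by apply: nearW => n; exact: bF.
have E := @gauss_iterS k F (fun z => (fin _ _ z cF bF').1).
have E_ n := @gauss_iterS k (F_ n) (fun z => (fin _ _ z (cF_ n) (bF n)).1).
have i1 := int _ _ cF bF'.
rewrite /gauss_real E.
under eq_fun do rewrite E_.
apply: fine_cvg; rewrite fineK; last exact: (integrable_fin_num measurableT i1).
apply: (@dominated_cvg _ _ _ mu setT measurableT _ _ (fun z => (phi z * M)%:E)) => //.
- move=> n; apply/measurable_EFinP; apply: measurable_funM; first exact: measurable_normal_pdf.
  exact: cgi (cF_ n) (bF n).
- move=> z _; apply: cvg_EFin; first exact: nearW.
  apply: cvgM; first exact: cvg_cst.
  apply: (IH2 _ _ M) => [n||n v|v].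
  + exact: seq_continuous_upd.
  + exact: seq_continuous_upd.
  + exact: bF.
  + exact: FF.
- by apply: (@integrable_phiM _ _ `|M|).
- move=> n z _; rewrite /= lee_fin normrM ger0_norm ?normal_pdf_ge0//.
  by rewrite ler_wpM2l ?normal_pdf_ge0// (fin _ _ z (cF_ n) (bF n)).2.
Qed.

Lemma gauss_iter_fin k F M : seq_continuous F -> (forall v, `|F v| <= M) ->
  gauss_iter k F = (gauss_real k F)%:E.
Proof. by move=> cF bF; rewrite fineK// ((gauss_iter_dominated k).1 F M cF bF).1. Qed.

Lemma gauss_realS k F M : seq_continuous F -> (forall v, `|F v| <= M) ->
  mu.-integrable setT (EFin \o (fun z => phi z * gauss_real k (F \o upd k z))) /\
  gauss_real k.+1 F = \int[mu]_z (phi z * gauss_real k (F \o upd k z)).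
Proof.
move=> cF bF; have fin z := (gauss_iter_dominated k).1 (F \o upd k z) M
  (seq_continuous_upd cF) (fun v => bF _).
split; last by rewrite /gauss_real gauss_iterS// => z; exact: (fin z).1.
apply: (@integrable_phiM _ _ M); last by move=> z; exact: (fin z).2.
apply: continuous_measurable_fun => z.
apply/(@cvg_nbhsP _ R^o) => u uz.
apply: ((gauss_iter_dominated k).2 _ _ M) => [n||n v|v].
- exact: seq_continuous_upd.
- exact: seq_continuous_upd.
- exact: bF.
- by apply: cF => i; rewrite /upd; case: ifP => _ //; exact: cvg_cst.
Qed.

Lemma gauss_real_linear k (a : R) F G M N : seq_continuous F -> seq_continuous G ->
  (forall v, `|F v| <= M) -> (forall v, `|G v| <= N) ->
  gauss_real k (fun v => a * F v + G v) = a * gauss_real k F + gauss_real k G.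
Proof.
elim: k F G => [//|k IH] F G cF cG bF bG.
have cFG : seq_continuous (fun v => a * F v + G v).
  by move=> v_ v vv; apply: cvgD; [apply: cvgM; [exact: cvg_cst|exact: cF]|exact: cG].
have bFG v : `|a * F v + G v| <= `|a| * M + N.
  by rewrite (le_trans (ler_normD _ _))// lerD// normrM ler_wpM2l.
have [iF ->] := gauss_realS k cF bF.
have [iG ->] := gauss_realS k cG bG.
have [_ ->] := gauss_realS k cFG bFG.
rewrite -RintegralZl// -RintegralD//; last exact: (integrableZl measurableT a iF).
apply: eq_Rintegral => z _.
rewrite [X in phi z * X](IH (F \o upd k z) (G \o upd k z)); first by ring.
- exact: seq_continuous_upd.
- exact: seq_continuous_upd.
- by move=> v; exact: bF.
- by move=> v; exact: bG.
Qed.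

Lemma cvg_sumr (T I : Type) (FT : set_system T) {FF : Filter FT} (r : seq I)
    (P : pred I) (f : I -> T -> R) (l : I -> R) :
  (forall i, P i -> f i x @[x --> FT] --> l i) ->
  \sum_(i <- r | P i) f i x @[x --> FT] --> \sum_(i <- r | P i) l i.
Proof. by move=> fl; apply: cvg_big => //; exact: add_continuous. Qed.

(** The phase has to vary in the induction: freezing the last coordinate at [z] shifts the phase by
    [a k * z], and integrating that shift is [gcosE]. *)
Lemma gauss_real_cos k (a : nat -> R) (th : R) :
  gauss_real k (fun v => cos (\sum_(i < k) a i * v i + th)) =
  expR (- (\sum_(i < k) a i ^+ 2) / 2) * cos th.
Proof.
elim: k th => [|k IH] th.
  by rewrite /gauss_real/= !big_ord0 add0r oppr0 mul0r expR0 mul1r.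
have cF : seq_continuous (fun v => cos (\sum_(i < k.+1) a i * v i + th)).
  move=> v_ v vv; apply: continuous_cvg; first exact: continuous_cos.
  apply: cvgD; last exact: cvg_cst.
  apply: cvg_sumr => i _; apply: cvgM; [exact: cvg_cst|exact: vv].
have [_ ->] := gauss_realS k cF (fun v => cos_max _).
have E z : gauss_real k ((fun v => cos (\sum_(i < k.+1) a i * v i + th)) \o upd k z) =
    expR (- (\sum_(i < k) a i ^+ 2) / 2) * cos (a k * z + th).
  rewrite -IH; congr gauss_real; apply/funext => v /=.
  rewrite big_ord_recr/= {2}/upd eqxx -addrA; congr (cos (_ + _)).
  by apply: eq_bigr => i _; rewrite /upd ltn_eqF.
transitivity (expR (- (\sum_(i < k) a i ^+ 2) / 2) * gcos th (a k)).
  rewrite /gcos -RintegralZl//.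
    by apply: eq_Rintegral => z _; rewrite E; ring.
  apply: (@integrable_phiM _ _ 1); last by move=> z; exact: cos_max.
  by apply: measurable_trig; exact: continuous_cos.
by rewrite gcosE mulrA -expRD big_ord_recr/= opprD mulrDl.
Qed.

End GaussIter.

(** * Approximation by trigonometric polynomials *)

Section Bernstein.
Context {R : realType}.
Implicit Types (G H : nat -> R) (s a c e K : R).

(** The mean of [G] at a binomial variable with parameters [N] and [s], computed by conditioning on
    one trial. It is the Bernstein polynomial of [G], written without binomial coefficients. *)
Fixpoint bern (N : nat) (G : nat -> R) (s : R) : R :=
  if N is N'.+1 then s * bern N' (G \o succn) s + (1 - s) * bern N' G s else G 0%N.

Lemma bern_le N G H s : 0 <= s <= 1 ->
  (forall k, (k <= N)%N -> G k <= H k) -> bern N G s <= bern N H s.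
Proof.
move=> /andP[s0 s1]; elim: N G H => [|N IH] G H GH /=; first exact: GH.
apply: lerD; apply: ler_wpM2l => //.
- by apply: IH => k kN; exact: GH.
- by rewrite subr_ge0.
- by apply: IH => k kN; apply: GH; exact: leqW.
Qed.

Lemma bern_lin N G H a s :
  bern N (fun k => a * G k + H k) s = a * bern N G s + bern N H s.
Proof.
elim: N G H => [//|N IH] G H /=.
by rewrite (IH (G \o succn) (H \o succn)) IH; ring.
Qed.

Lemma bern_cst N c s : bern N (fun=> c) s = c.
Proof. by elim: N => [//|N IH] /=; rewrite [bern N _ _]IH; ring. Qed.

(** Binomial variance [N s (1 - s)] plus squared bias. *)
Lemma bern_sqr N a s :
  bern N (fun k => (k%:R - a) ^+ 2) s = N%:R * s * (1 - s) + (N%:R * s - a) ^+ 2.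
Proof.
elim: N a => [|N IH] a /=; first by ring.
have -> : (fun k : nat => (k%:R - a) ^+ 2) \o succn = (fun k => (k%:R - (a - 1)) ^+ 2).
  by apply/funext => k /=; rewrite -natr1; congr (_ ^+ 2); ring.
by rewrite !IH -natr1; ring.
Qed.

(** A quadratic majorant is averaged exactly by [bern_sqr]: the mean of [(k / N - s)^2] is
    [s (1 - s) / N], and [s (1 - s) <= 1 / 4]. *)
Lemma bern_approx N G s c e K : (0 < N)%N -> 0 <= s <= 1 -> 0 <= K ->
  (forall k, (k <= N)%N -> `|G k - c| <= e + K * (k%:R / N%:R - s) ^+ 2) ->
  `|bern N G s - c| <= e + K / (4 * N%:R).
Proof.
move=> N0 s01 K0 GH.
have Np : 0 < N%:R :> R by rewrite ltr0n.
pose Q k : R := K / N%:R ^+ 2 * (k%:R - N%:R * s) ^+ 2 + e.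
have QE : bern N Q s <= e + K / (4 * N%:R).
  rewrite /Q bern_lin bern_cst bern_sqr subrr expr0n addr0 addrC lerD2l.
  have -> : K / N%:R ^+ 2 * (N%:R * s * (1 - s)) = K / N%:R * (s * (1 - s)).
    by field; rewrite gt_eqF.
  have -> : K / (4 * N%:R) = K / N%:R * 4^-1 by field; rewrite gt_eqF.
  rewrite ler_wpM2l ?divr_ge0 ?(ltW Np)//.
  by have := sqr_ge0 (s - 2^-1); rewrite expr2; lra.
have h k : (k <= N)%N -> `|G k - c| <= Q k.
  move=> /GH; suff -> : e + K * (k%:R / N%:R - s) ^+ 2 = Q k by [].
  by rewrite /Q; field; rewrite gt_eqF.
rewrite ler_norml; apply/andP; split.
  rewrite lerNl; apply: le_trans QE.
  have -> : - (bern N G s - c) = bern N (fun k => -1 * G k + c) s.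
    by rewrite (bern_lin N G (fun=> c)) bern_cst; ring.
  apply: bern_le => // k kN.
  by apply: le_trans (h k kN); rewrite mulN1r addrC -opprB -normrN; exact: ler_norm.
apply: le_trans QE.
have -> : bern N G s - c = bern N (fun k => 1 * G k + (- c)) s.
  by rewrite (bern_lin N G (fun=> - c)) bern_cst; ring.
apply: bern_le => // k kN.
by apply: le_trans (h k kN); rewrite mul1r; exact: ler_norm.
Qed.

Lemma bern_norm N G s c : 0 <= s <= 1 ->
  (forall k, (k <= N)%N -> `|G k| <= c) -> `|bern N G s| <= c.
Proof.
move=> s01 GH; rewrite ler_norml; apply/andP; split.
  rewrite -(bern_cst N (- c) s); apply: bern_le => // k /GH.
  by rewrite ler_norml => /andP[].
rewrite -[leRHS](bern_cst N c s); apply: bern_le => // k /GH.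
by rewrite ler_norml => /andP[].
Qed.

End Bernstein.

Lemma lipschitz_continuous {R : realType} {W : normedModType R} (g : W -> R) (K : R) : (forall x y, `|g x - g y| <= K * `|x - y|) ->
  continuous g.
Proof.
move=> lip x; apply/cvgrPdist_lt => e e0.
have K1 : 0 < `|K| + 1 by rewrite ltr_pwDr.
have d0 : 0 < e / (`|K| + 1) by rewrite divr_gt0.
near=> y.
apply: le_lt_trans (lip _ _) _.
apply: (@le_lt_trans _ _ ((`|K| + 1) * `|x - y|)).
  by rewrite ler_wpM2r// (le_trans (ler_norm _))// lerDl.
by rewrite mulrC -ltr_pdivlMr//; near: y; exact: cvgr_dist_lt.
Unshelve. all: by end_near. Qed.

(** * Real trigonometric polynomials in several variables *)

Section TrigPoly.
Context {R : realType} {p : nat}.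
Notation V := 'cV[R]_p.
Implicit Types (t x y : V) (f g h : V -> R) (th a c : R).

Definition dotp (t x : V) : R := (t^T *m x) 0 0.

Lemma dotpE t x : dotp t x = \sum_j t j 0 * x j 0.
Proof. by rewrite /dotp mxE; apply: eq_bigr => j _; rewrite mxE. Qed.

Lemma dotpDl t t' x : dotp (t + t') x = dotp t x + dotp t' x.
Proof. by rewrite /dotp linearD mulmxDl mxE. Qed.

Lemma dotpBl t t' x : dotp (t - t') x = dotp t x - dotp t' x.
Proof. by rewrite /dotp linearB mulmxBl !mxE. Qed.

Lemma dotpBr t x y : dotp t (x - y) = dotp t x - dotp t y.
Proof. by rewrite /dotp mulmxBr !mxE. Qed.

Lemma dotp0l x : dotp 0 x = 0.
Proof. by rewrite /dotp linear0 mul0mx mxE. Qed.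

Lemma coord_le_norm x j : `|x j 0| <= `|x|.
Proof.
rewrite [leRHS]mx_normrE.
exact: (le_bigmax_cond _ (fun ij => `|x ij.1 ij.2|) (j := (j, 0))).
Qed.

Lemma norm_le_coord x c : 0 <= c -> (forall j, `|x j 0| <= c) -> `|x| <= c.
Proof.
move=> c0 xc; rewrite [leLHS]mx_normrE; apply: bigmax_le => // -[i j] _.
by rewrite (ord1 j).
Qed.

Lemma dotp_le t x : `|dotp t x| <= (\sum_j `|t j 0|) * `|x|.
Proof.
rewrite dotpE; apply: le_trans (ler_norm_sum _ _ _) _.
rewrite mulr_suml; apply: ler_sum => j _.
by rewrite normrM ler_wpM2l// coord_le_norm.
Qed.

(** Phases make sines and constants instances of the first constructor, and the product-to-sum
    formula yields closure under products, so linear combinations are the only other constructor. *)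
Inductive trigpoly : (V -> R) -> Prop :=
| trigpoly_cos t th : trigpoly (fun x => cos (dotp t x + th))
| trigpoly_lin a g h : trigpoly g -> trigpoly h -> trigpoly (fun x => a * g x + h x).

Lemma eq_trigpoly g h : g =1 h -> trigpoly g -> trigpoly h.
Proof. by move=> /funext ->. Qed.

Lemma trigpoly0 : trigpoly (fun=> 0).
Proof.
by apply: eq_trigpoly (trigpoly_cos 0 (pi / 2)) => x; rewrite dotp0l add0r cos_pihalf.
Qed.

Lemma trigpoly_scale a g : trigpoly g -> trigpoly (fun x => a * g x).
Proof.
by move=> tg; apply: eq_trigpoly (trigpoly_lin a tg trigpoly0) => x; rewrite addr0.
Qed.

Lemma trigpoly_add g h : trigpoly g -> trigpoly h -> trigpoly (fun x => g x + h x).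
Proof.
by move=> tg th; apply: eq_trigpoly (trigpoly_lin 1 tg th) => x; rewrite mul1r.
Qed.

Lemma trigpoly_cst c : trigpoly (fun=> c).
Proof.
apply: eq_trigpoly (trigpoly_scale c (trigpoly_cos 0 0)) => x.
by rewrite dotp0l addr0 cos0 mulr1.
Qed.

Lemma trigpoly_mul g h : trigpoly g -> trigpoly h -> trigpoly (fun x => g x * h x).
Proof.
move=> tg; elim: tg h => [t th|a g1 g2 _ IH1 _ IH2] h tH; last first.
  apply: eq_trigpoly (trigpoly_lin a (IH1 _ tH) (IH2 _ tH)) => x.
  by rewrite mulrDl mulrA.
elim: tH => [t' th'|a h1 h2 _ IH1 _ IH2]; last first.
  by apply: eq_trigpoly (trigpoly_lin a IH1 IH2) => x; ring.
apply: eq_trigpoly (trigpoly_add (trigpoly_scale 2^-1 (trigpoly_cos (t + t') (th + th')))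
  (trigpoly_scale 2^-1 (trigpoly_cos (t - t') (th - th')))) => x.
rewrite dotpDl dotpBl; set a := dotp t x; set b := dotp t' x.
have -> : a + b + (th + th') = (a + th) + (b + th') by ring.
have -> : a - b + (th - th') = (a + th) - (b + th') by ring.
by rewrite cosD cosB; field.
Qed.

Lemma trigpoly_sin_coord (w : R) j : trigpoly (fun x => sin (w * x j 0)).
Proof.
apply: eq_trigpoly (trigpoly_cos (w *: delta_mx j 0) (- (pi / 2))) => x.
rewrite cosBpihalf dotpE (bigD1 j)//= big1 ?addr0 => [|i ij].
  by rewrite !mxE !eqxx mulr1.
by rewrite !mxE (negbTE ij)/= mulr0 mul0r.
Qed.

Lemma trigpoly_bern N (G : nat -> V -> R) (s : V -> R) :
  trigpoly s -> (forall k, trigpoly (G k)) -> trigpoly (fun x => bern N (G ^~ x) (s x)).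
Proof.
move=> ts; elim: N G => [|N IH] G tG /=; first exact: tG.
apply: trigpoly_add; apply: trigpoly_mul => //.
- by apply: (IH (G \o succn)) => k; exact: tG.
- apply: trigpoly_add; first exact: trigpoly_cst.
  by apply: eq_trigpoly (trigpoly_scale (-1) ts) => x; rewrite mulN1r.
- exact: IH.
Qed.

Lemma trigpoly_bounded g : trigpoly g -> exists M, forall x, `|g x| <= M.
Proof.
elim=> [t th|a g1 g2 _ [M1 b1] _ [M2 b2]]; first by exists 1 => x; exact: cos_max.
exists (`|a| * M1 + M2) => x.
by rewrite (le_trans (ler_normD _ _))// lerD// normrM ler_wpM2l.
Qed.

Lemma trigpoly_lipschitz g : trigpoly g ->
  exists2 K : R, 0 <= K & forall x y, `|g x - g y| <= K * `|x - y|.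
Proof.
elim=> [t th|a g1 g2 _ [K1 K10 b1] _ [K2 K20 b2]].
  exists (\sum_j `|t j 0|); first exact: sumr_ge0.
  move=> x y; apply: le_trans (cos_lip _ _) _.
  by rewrite opprD addrACA subrr addr0 -dotpBr dotp_le.
exists (`|a| * K1 + K2); first by rewrite addr_ge0// mulr_ge0.
move=> x y.
have -> : a * g1 x + g2 x - (a * g1 y + g2 y) = a * (g1 x - g1 y) + (g2 x - g2 y) by ring.
by rewrite (le_trans (ler_normD _ _))// mulrDl lerD// normrM -mulrA ler_wpM2l.
Qed.

Lemma trigpoly_continuous g : trigpoly g -> continuous g.
Proof. by move=> /trigpoly_lipschitz[K _ /lipschitz_continuous]. Qed.

End TrigPoly.

(** * Approximation on a box with the sup bound kept everywhere *)

Section BoxApproximation.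
Context {R : realType} {p : nat}.
Notation V := 'cV[R]_p.
Implicit Types (x y : V) (f g : V -> R) (L M e eta d w z : R).

Definition box L x := forall j, `|x j 0| <= L.

Lemma trmx_normB (r s : 'rV[R]_p) : `|r^T - s^T| = `|r - s|.
Proof.
rewrite -linearB/=; move: (r - s) => {r s} r.
rewrite [LHS]mx_normrE [RHS]mx_normrE; apply/eqP; rewrite eq_le; apply/andP; split.
  apply: bigmax_le => [|[i j] _]; first exact: bigmax_ge_id.
  rewrite mxE; exact: (le_bigmax_cond _ (fun ij => `|r ij.1 ij.2|) (j := (j, i))).
apply: bigmax_le => [|[i j] _]; first exact: bigmax_ge_id.
have -> : `|r (i, j).1 (i, j).2| = `|r^T j i| by rewrite mxE.
exact: (le_bigmax_cond _ (fun ij => `|r^T ij.1 ij.2|) (j := (j, i))).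
Qed.

(** Compactness is applied to a box of row vectors, hence the transposes. Around each point, half
    the radius of continuity serves all nearby points; [y] may leave the box. *)
Lemma uniform_on_box f L e : continuous f -> 0 < e ->
  exists2 eta, 0 < eta & forall x y, box L x -> `|x - y| < eta -> `|f x - f y| <= e.
Proof.
move=> cf e0.
pose K := [set r : 'rV[R]_p | forall j, `[- L, L]%classic (r 0 j)].
have cK : compact K by apply: (@rV_compact R p (fun=> `[- L, L]%classic)) => _; exact: segment_compact.
pose Q eta (r : 'rV[R]_p) := forall y, `|r^T - y| < eta -> `|f r^T - f y| <= e.
have near_Q (r : 'rV[R]_p) : K r -> \forall r' \near r & eta \near (0 : R)^'+, Q eta r'.
  move=> _.
  have e20 : 0 < e / 2 by rewrite divr_gt0.
  have [d /= d0 fd] : exists2 d, 0 < d & forall z : V, `|r^T - z| < d -> `|f r^T - f z| < e / 2.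
    have /cvgr_dist_lt/(_ _ e20)/nbhs_ballP[d /= d0 fd] := cf r^T.
    by exists d => // z rz; apply: fd; rewrite -ball_normE.
  exists (ball r (d / 2), [set eta | eta < d / 2]).
    split; first by apply: nbhsx_ballx; rewrite divr_gt0.
    by apply: nbhs_right_lt; rewrite divr_gt0.
  move=> [r' eta] [/=]; rewrite -ball_normE/= => rr' etad y r'y.
  have h1 : `|r^T - r'^T| < d by rewrite trmx_normB; apply: (lt_le_trans rr'); lra.
  have h2 : `|r^T - y| < d.
    apply: le_lt_trans (ler_distD r'^T _ _) _.
    by rewrite trmx_normB; lra.
  apply: le_trans (ler_distD (f r^T) _ _) _.
  by have := fd _ h1; have := fd _ h2; rewrite distrC; lra.
have /compact_near_coveringP/(_ _ (0 : R)^'+ Q _ near_Q) KQ := cK.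
near (0 : R)^'+ => eta.
exists eta; first by near: eta; exact: nbhs_right_gt.
move=> x y bx xy.
suff : Q eta x^T by rewrite /Q trmxK; exact.
apply: (near KQ eta) => //.
by move=> j /=; rewrite mxE in_itv/= -ler_norml.
Unshelve. all: by end_near. Qed.

Definition upd_coord x (j : 'I_p) (z : R) : V := \col_i (if i == j then z else x i 0).

Lemma upd_coord_box L x j z : box L x -> `|z| <= L -> box L (upd_coord x j z).
Proof. by move=> bx zL i; rewrite mxE; case: ifP. Qed.

Lemma upd_coord_dist x y j z : `|upd_coord x j z - upd_coord y j z| <= `|x - y|.
Proof.
apply: norm_le_coord => // i; rewrite !mxE; case: ifP => _.
  by rewrite subrr normr0.
by have := coord_le_norm (x - y) i; rewrite !mxE.
Qed.

Lemma upd_coord_dist_id x j z : `|x - upd_coord x j z| <= `|x j 0 - z|.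
Proof.
apply: norm_le_coord => // i; rewrite !mxE; case: eqP => [->//|_].
by rewrite subrr normr0.
Qed.

(* [bern_multi] applies a Bernstein operator in each coordinate of [js], read through
   the change of variable [s]; [node k] is the point that [s] sends to [k / N]. *)
Fixpoint bern_multi (N : nat) (node : nat -> R) (s : R -> R) (js : seq 'I_p)
    (f : V -> R) (x : V) : R :=
  if js is j :: js' then
    bern N (fun k => bern_multi N node s js' (fun y => f (upd_coord y j (node k))) x)
      (s (x j 0))
  else f x.

Lemma bern_multi_norm N node s js f M x : (forall z, 0 <= s z <= 1) ->
  (forall y, `|f y| <= M) -> `|bern_multi N node s js f x| <= M.
Proof.
move=> s01; elim: js f => [|j js IH] f bf /=; first exact: bf.
by apply: bern_norm => // k _; apply: IH => y; exact: bf.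
Qed.

(** Each step freezes one coordinate of [f] at a node. When [js] is exhausted the remaining function
    depends on no coordinate, so it is a constant; the second hypothesis tracks this dependence. *)
Lemma bern_multi_trigpoly N node s js f :
  (forall j : 'I_p, trigpoly (fun x => s (x j 0))) ->
  (forall x y, (forall j, j \in js -> x j 0 = y j 0) -> f x = f y) ->
  trigpoly (bern_multi N node s js f).
Proof.
move=> ts; elim: js f => [|j js IH] f fjs /=.
  by apply: eq_trigpoly (trigpoly_cst (f 0)) => x; apply: fjs.
apply: (trigpoly_bern N (G := fun k x => bern_multi N node s js (fun y => f (upd_coord y j (node k))) x)).
  exact: ts.
move=> k; apply: IH => x y xy; apply: fjs => i; rewrite !mxE in_cons.
by case: eqP => //= _ /xy.
Qed.

(** Each coordinate costs one use of [bern_approx] with [K = 2 M / d^2]. If [k / N] is within [d] of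
    [s (x j)], the node is close to [x j] and [f] moves by at most [e]; otherwise the crude bound
    [2 M] is at most [K (k / N - s (x j))^2]. *)
Lemma bern_multi_approx N node (s : R -> R) js f L M e eta d : (0 < N)%N -> 0 < d -> 0 <= e ->
  (forall z, 0 <= s z <= 1) ->
  (forall k, (k <= N)%N -> `|node k| <= L) ->
  (forall k z, (k <= N)%N -> `|z| <= L -> `|k%:R / N%:R - s z| < d -> `|z - node k| < eta) ->
  (forall x, `|f x| <= M) ->
  (forall x y, box L x -> box L y -> `|x - y| < eta -> `|f x - f y| <= e) ->
  forall x, box L x ->
  `|bern_multi N node s js f x - f x| <= (size js)%:R * (e + 2 * M / d ^+ 2 / (4 * N%:R)).
Proof.
move=> N0 d0 e1 s01 nodeL node_s; set E := e + _.
elim: js f => [|j js IH] f bf uf x bx; first by rewrite /= subrr normr0 mul0r.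
have M0 : 0 <= M by apply: le_trans (bf 0).
have e0 : 0 <= 2 * M / d ^+ 2 by rewrite divr_ge0 ?sqr_ge0 ?mulr_ge0//.
pose G k := bern_multi N node s js (fun y => f (upd_coord y j (node k))) x.
have IHk k : (k <= N)%N -> `|G k - f (upd_coord x j (node k))| <= (size js)%:R * E.
  move=> kN; apply: (IH (fun y => f (upd_coord y j (node k)))) => //.
  move=> y z by_ bz yz; apply: uf; [| |].
  - by apply: upd_coord_box => //; exact: nodeL.
  - by apply: upd_coord_box => //; exact: nodeL.
  - exact: le_lt_trans (upd_coord_dist _ _ _ _) yz.
have -> : (size (j :: js))%:R * E = ((size js)%:R * E + e) + 2 * M / d ^+ 2 / (4 * N%:R).
  by rewrite /= -natr1 mulrDl mul1r /E; ring.
rewrite /= -/(G _); apply: bern_approx => // k kN.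
apply: le_trans (ler_distD (f (upd_coord x j (node k))) _ _) _.
rewrite -addrA; apply: lerD; first exact: IHk.
have [kd|kd] := ltP `|k%:R / N%:R - s (x j 0)| d.
  rewrite distrC; apply: (@le_trans _ _ e); last by rewrite lerDl mulr_ge0 ?sqr_ge0.
  apply: uf => //; first by apply: upd_coord_box => //; exact: nodeL.
  apply: le_lt_trans (upd_coord_dist_id _ _ _) _.
  exact: node_s.
apply: (@le_trans _ _ (2 * M)).
  by rewrite mulr_natl mulr2n (le_trans (ler_normB _ _))// lerD.
rewrite -[leLHS]add0r lerD// -[leLHS]mulr1 -[leRHS]mulrA ler_wpM2l ?mulr_ge0//.
rewrite mulrC ler_pdivlMr ?exprn_gt0// mul1r -[leRHS]real_normK ?num_real//.
by rewrite lerXn2r ?nnegrE// ltW.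
Qed.

Lemma trigpoly_approx f L M e : continuous f -> (forall x, `|f x| <= M) ->
  0 < L -> 0 < e ->
  exists g, [/\ trigpoly g, forall x, `|g x| <= M &
    forall x, box L x -> `|g x - f x| <= e].
Proof.
move=> cf bf L0 e0.
have M0 : 0 <= M by apply: le_trans (bf 0).
(* Each of the [p] coordinates will cost at most [e1] for the oscillation of [f] and [e1] for the
   binomial variance; [p + 1] also covers [p = 0]. *)
have e10 : 0 < e / (2 * p.+1%:R) by rewrite divr_gt0// mulr_gt0.
have [eta0 eta00 uf] := uniform_on_box L cf e10.
set e1 := e / _ in e10 uf.
pose eta := Num.min eta0 L.
have eta_gt0 : 0 < eta by rewrite lt_min eta00.
have etaL : eta <= L by rewrite ge_min lexx orbT.
have pi0 := @pi_gt0 R.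
(* Scaling by [w] maps [-L, L] onto [-pi/2, pi/2], where sine is injective. Thus [s] maps [-L, L]
   bijectively onto [0, 1], and [node k] is the preimage of [k / N]. *)
pose w := pi / (2 * L).
have w0 : 0 < w by rewrite divr_gt0// mulr_gt0.
have wL : w * L = pi / 2 by rewrite /w; field; rewrite gt_eqF.
pose s z := (1 + sin (w * z)) / 2.
have s01 z : 0 <= s z <= 1.
  have := sin_le1 (w * z); have := sin_geN1 (w * z).
  by rewrite /s => h1 h2; apply/andP; split; lra.
(* Half the separation given by [sin_separated], since [s] halves the sine. The cap [eta <= L] gives
   [w eta <= pi / 2], so that [d] is positive. *)
pose d := sin (w * eta / 2) ^+ 2.
have weta : w * eta <= pi / 2 by rewrite -wL ler_pM2l.
have weta0 : 0 < w * eta by rewrite mulr_gt0.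
have d0 : 0 < d by rewrite exprn_gt0// sin_gt0_pi//; apply/andP; split; lra.
have [K [KE K0]] : exists K, K = 2 * M / d ^+ 2 /\ 0 <= K.
  by exists (2 * M / d ^+ 2); split=> //; rewrite divr_ge0 ?sqr_ge0 ?mulr_ge0.
have [N N0 KN] : exists2 N : nat, (0 < N)%N & K / (4 * N%:R) <= e1.
  exists (Num.bound (K / e1)).+1 => //.
  have : K / e1 <= (Num.bound (K / e1)).+1%:R.
    by apply: le_trans (ltW (archi_boundP _)) _; rewrite ?ler_nat// divr_ge0// ltW.
  have : (0 : R) < (Num.bound (K / e1)).+1%:R by rewrite ltr0n.
  move: (_.+1%:R : R) => n n0; rewrite ler_pdivrMr// ler_pdivrMr ?mulr_gt0//.
  by move: e10; nra.
pose node k := asin (2 * (k%:R / N%:R) - 1) / w.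
have Np : 0 < N%:R :> R by rewrite ltr0n.
have in1 k : (k <= N)%N -> -1 <= 2 * (k%:R / N%:R : R) - 1 <= 1.
  move=> kN.
  have h0 : 0 <= k%:R / N%:R :> R by rewrite divr_ge0.
  have h1 : k%:R / N%:R <= 1 :> R by rewrite ler_pdivrMr// mul1r ler_nat.
  by apply/andP; split; lra.
have nodeL k : (k <= N)%N -> `|node k| <= L.
  move=> /in1 kN; rewrite /node normrM [`|w^-1|]gtr0_norm ?invr_gt0// ler_pdivrMr//.
  rewrite [L * w]mulrC wL ler_norml asin_lepi2// andbT.
  exact: asin_geNpi2.
have node_s k z : (k <= N)%N -> `|z| <= L -> `|k%:R / N%:R - s z| < d -> `|z - node k| < eta.
  move=> kN zL; apply: contraTT; rewrite -!leNgt => zk.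
  have wz : - (pi / 2) <= w * z <= pi / 2.
    by rewrite -ler_norml normrM gtr0_norm// -wL ler_pM2l.
  have wn : - (pi / 2) <= asin (2 * (k%:R / N%:R) - 1 : R) <= pi / 2.
    by rewrite asin_geNpi2 ?asin_lepi2 ?in1.
  have hh : 0 < w * eta <= `|w * z - asin (2 * (k%:R / N%:R) - 1 : R)|.
    have -> : asin (2 * (k%:R / N%:R) - 1) = w * node k.
      by rewrite /node [w * _]mulrC divfK// gt_eqF.
    by rewrite weta0 -mulrBr normrM gtr0_norm// ler_pM2l.
  have := sin_separated wz wn hh.
  rewrite asinK ?in_itv/= ?in1//.
  have -> : sin (w * z) - (2 * (k%:R / N%:R) - 1) = - 2 * (k%:R / N%:R - s z).
    by rewrite /s; field; rewrite gt_eqF.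
  by rewrite normrM normrN (ger0_norm (ler0n _ 2)) ler_pM2l.
exists (bern_multi N node s (enum 'I_p) f); split.
- apply: bern_multi_trigpoly.
    move=> j; apply: eq_trigpoly (trigpoly_add (trigpoly_cst 2^-1) (trigpoly_scale 2^-1 (trigpoly_sin_coord w j))) => x.
    by rewrite /s; field.
  by move=> x y xy; congr f; apply/matrixP => i k; rewrite (ord1 k) xy// mem_enum.
- by move=> x; apply: bern_multi_norm.
- move=> x bx.
  have uf' y (z : V) : box L y -> box L z -> `|y - z| < eta -> `|f y - f z| <= e1.
    by move=> by_ _ yz; apply: uf => //; apply: (lt_le_trans yz); rewrite ge_min lexx.
  apply: le_trans (bern_multi_approx _ N0 d0 (ltW e10) s01 nodeL node_s bf uf' bx) _.
  rewrite size_enum_ord -KE.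
  apply: (@le_trans _ _ (p.+1%:R * (e1 + e1))).
    by apply: ler_pM; rewrite ?ler_nat ?lerD2l// addr_ge0 ?(ltW e10)// divr_ge0 ?mulr_ge0.
  suff -> : p.+1%:R * (e1 + e1) = e by [].
  by rewrite /e1; field; rewrite addrC natr1 pnatr_eq0.
Qed.

End BoxApproximation.

(** * Convergence in distribution from cosines *)

Section Levy.
Context {R : realType} {p : nat} {d : measure_display} {T : measurableType d}
  (P : probability T R).
Notation V := 'cV[R]_p.
Implicit Types (f g : V -> R) (X : T -> V) (M L : R).

Lemma bounded_integrable (h : T -> R) (M : R) : measurable_fun setT h ->
  (forall w, `|h w| <= M) -> P.-integrable setT (EFin \o h).
Proof.
move=> mh hM; apply: measurable_bounded_integrable => //.
  by rewrite -ge0_fin_numE// fin_num_measure.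
by exists M; split; [exact: num_real|move=> x Mx z _; exact: le_trans (hM z) (ltW Mx)].
Qed.

Lemma mean_cst (c : R) : \int[P]_w c = c.
Proof.
rewrite Rintegral_cst// -[RHS]mulr1; congr (_ * _).
exact: (congr1 fine (probability_setT P)).
Qed.

Definition coord_measurable X := forall j, measurable_fun setT (fun w => X w j 0).

Lemma measurable_dotp X t : coord_measurable X -> measurable_fun setT (fun w => dotp t (X w)).
Proof.
move=> mX; under eq_fun do rewrite dotpE.
by apply: measurable_sum => j; apply: measurable_funM => //; exact: mX.
Qed.

Lemma measurable_trigpoly X g : coord_measurable X -> trigpoly g ->
  measurable_fun setT (g \o X).
Proof.
move=> mX; elim=> [t th|a g1 g2 _ IH1 _ IH2].
  apply: (measurableT_comp (f := cos)); first exact: continuous_measurable_fun (@continuous_cos R).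
  by apply: measurable_funD => //; exact: measurable_dotp.
by apply: measurable_funD => //; exact: measurable_funM.
Qed.

Lemma norm_col_bigmax (x : V) : `|x| = \big[Num.max/0]_j `|x j 0|.
Proof.
apply/eqP; rewrite eq_le; apply/andP; split.
  apply: norm_le_coord => [|j]; first exact: bigmax_ge_id.
  exact: (le_bigmax_cond _ (fun j => `|x j 0|)).
by apply: bigmax_le => // j _; exact: coord_le_norm.
Qed.

Lemma measurable_norm X : coord_measurable X -> measurable_fun setT (fun w => `|X w|).
Proof.
move=> mX.
have -> : (fun w => `|X w|) = (fun w => \big[Num.max/0]_j `|X w j 0|).
  by apply/funext => w; exact: norm_col_bigmax.
elim: (index_enum _) => [|j s IH].
  by under eq_fun do rewrite big_nil; exact: measurable_cst.
under eq_fun do rewrite big_cons.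
apply: measurable_maxr => //.
by apply: measurableT_comp => //; exact: mX.
Qed.

Lemma measurable_norm_gt X L : coord_measurable X -> measurable [set w | L < `|X w|].
Proof.
move=> /measurable_norm mX.
have := mX measurableT _ (measurable_itv `]L, +oo[); rewrite setTI.
suff -> : [set w | L < `|X w|] = (fun w : T => `|X w|) @^-1` `]L, +oo[ by [].
by apply/seteqP; split => w /=; rewrite in_itv/= andbT.
Qed.

Lemma cvg_col (x_ : nat -> V) (x : V) : (forall j, x_ n j 0 @[n --> \oo] --> x j 0) ->
  x_ n @[n --> \oo] --> x.
Proof.
move=> xx; apply/cvgrPdist_le => e e0; near=> n.
apply: norm_le_coord; first exact: ltW.
near: n; apply: filter_forall => j.
have /cvgrPdist_le/(_ _ e0) := xx j.
by apply: filterS => n; rewrite !mxE.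
Unshelve. all: by end_near. Qed.

Definition gauss_mean (A : 'M[R]_p) f : R := gauss_real p (fun v => f (A *m \col_i v i)).

Lemma seq_continuous_mulmx (A : 'M[R]_p) f : continuous f ->
  seq_continuous (fun v => f (A *m \col_(i < p) v i)).
Proof.
move=> cf v_ v vv; apply: (@cvg_comp _ _ _ (fun n => A *m \col_i v_ n i) f _ _ _ _ (cf _)).
apply: cvg_col => j; rewrite mxE; under eq_fun do rewrite mxE.
apply: cvg_sumr => i _; apply: cvgM; first exact: cvg_cst.
by rewrite mxE; under eq_fun do rewrite mxE; exact: vv.
Qed.

Lemma gauss_expectE (A : 'M[R]_p) f M : continuous f -> (forall x, `|f x| <= M) ->
  gauss_expect A f = (gauss_mean A f)%:E.
Proof.
move=> cf bf; apply: gauss_iter_fin; first exact: seq_continuous_mulmx.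
by move=> v; exact: bf.
Qed.

(** The argument is [dotp (A^T t) v], with variance [|A^T t|^2 = t^T A A^T t]. Only [A A^T] enters,
    so every factor of the covariance gives the same limit. *)
Lemma gauss_mean_cos (A : 'M[R]_p) t th :
  gauss_mean A (fun x => cos (dotp t x + th)) =
  expR (- dotp t (A *m A^T *m t) / 2) * cos th.
Proof.
(* The vector [A^T t] extended by zero to a sequence, as [gauss_real_cos] expects. *)
pose a (i : nat) := oapp (fun j : 'I_p => (A^T *m t) j 0) 0 (insub i).
have aE (i : 'I_p) : a i = (A^T *m t) i 0 by rewrite /a valK.
have -> : dotp t (A *m A^T *m t) = \sum_(i < p) a i ^+ 2.
  rewrite /dotp -!mulmxA mulmxA -[t^T *m A]trmxK trmx_mul trmxK mxE.
  by apply: eq_bigr => i _; rewrite mxE aE.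
rewrite -gauss_real_cos /gauss_mean; congr gauss_real; apply/funext => v.
congr (cos (_ + _)); rewrite /dotp mulmxA -[t^T *m A]trmxK trmx_mul trmxK mxE.
by apply: eq_bigr => i _; rewrite !mxE aE mxE.
Qed.

(** Measurability is known coordinatewise, hence for trigonometric polynomials of [X]; on growing
    boxes with shrinking error these converge pointwise to [f]. *)
Lemma continuous_measurable_comp X f M : coord_measurable X -> continuous f ->
  (forall x, `|f x| <= M) -> measurable_fun setT (f \o X).
Proof.
move=> mX cf bf.
have /choice[g gP] N : exists g, [/\ trigpoly g, forall x, `|g x| <= M &
    forall x, box N.+1%:R x -> `|g x - f x| <= harmonic N].
  by apply: (trigpoly_approx cf bf); [rewrite ltr0n|exact: harmonic_gt0].
apply: (measurable_fun_cvg (h := fun N => g N \o X)) => [N|w _].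
  by apply: measurable_trigpoly => //; have [] := gP N.
apply/cvgrPdist_le => e e0; near=> N.
have [_ _ gN] := gP N.
rewrite distrC; apply: le_trans (gN _ _) _.
  move=> j; apply: le_trans (coord_le_norm _ _) _.
  apply: (@le_trans _ _ N%:R); last by rewrite ler_nat.
  by near: N; exact: nbhs_infty_ger.
near: N.
have /cvgrPdist_le/(_ _ e0) := @cvg_harmonic R.
apply: filterS => N; rewrite sub0r normrN; apply: le_trans; exact: ler_norm.
Unshelve. all: by end_near. Qed.

Lemma trigpoly_mean_cvg (Z : nat -> T -> V) (A : 'M[R]_p) g :
  (forall n, coord_measurable (Z n)) ->
  (forall t th, \int[P]_w cos (dotp t (Z n w) + th) @[n --> \oo] -->
     gauss_mean A (fun x => cos (dotp t x + th))) ->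
  trigpoly g -> \int[P]_w g (Z n w) @[n --> \oo] --> gauss_mean A g.
Proof.
move=> mZ Zc; elim=> [t th|a g1 g2 t1 IH1 t2 IH2]; first exact: Zc.
have [M1 b1] := trigpoly_bounded t1.
have [M2 b2] := trigpoly_bounded t2.
have i1 n := bounded_integrable (measurable_trigpoly (mZ n) t1) (fun w => b1 (Z n w)).
have i2 n := bounded_integrable (measurable_trigpoly (mZ n) t2) (fun w => b2 (Z n w)).
have -> : gauss_mean A (fun x => a * g1 x + g2 x) = a * gauss_mean A g1 + gauss_mean A g2.
  apply: (gauss_real_linear p a (M := M1) (N := M2)) => //.
  - exact/seq_continuous_mulmx/trigpoly_continuous.
  - exact/seq_continuous_mulmx/trigpoly_continuous.
have -> : (fun n => \int[P]_w (a * g1 (Z n w) + g2 (Z n w))) =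
    (fun n => a * \int[P]_w g1 (Z n w) + \int[P]_w g2 (Z n w)).
  apply/funext => n; rewrite RintegralD//.
    by rewrite RintegralZl//; exact: i1.
  - exact: (integrableZl measurableT a (i1 n)).
  - exact: i2.
by apply: cvgD => //; apply: cvgM => //; exact: cvg_cst.
Qed.

Lemma levy_continuity (Z : nat -> T -> V) (A : 'M[R]_p) :
  (forall n, coord_measurable (Z n)) ->
  (forall e : R, 0 < e -> exists L, \forall n \near \oo,
     (P [set w | (L < `|Z n w|)%R] <= e%:E)%E) ->
  (forall t th, \int[P]_w cos (dotp t (Z n w) + th) @[n --> \oo] -->
     gauss_mean A (fun x => cos (dotp t x + th))) ->
  forall f, continuous f -> (exists M : R, forall x, `|f x| <= M) ->
  ('E_P[f \o Z n] @[n --> \oo] --> gauss_expect A f)%E.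
Proof.
move=> mZ tight Zc f cf [M bf].
have M0 : 0 <= M by apply: le_trans (bf 0).
rewrite (gauss_expectE A cf bf).
have If n := bounded_integrable (continuous_measurable_comp (mZ n) cf bf) (fun w => bf (Z n w)).
have -> : (fun n => 'E_P[f \o Z n]%E) = EFin \o (fun n => \int[P]_w f (Z n w)).
  apply/funext => n; rewrite unlock /= /Rintegral fineK//.
  exact: (integrable_fin_num measurableT (If n)).
apply: cvg_EFin; first exact: nearW.
have /choice[g gP] N : exists g, [/\ trigpoly g, forall x, `|g x| <= M &
    forall x, box N.+1%:R x -> `|g x - f x| <= harmonic N].
  by apply: (trigpoly_approx cf bf); [rewrite ltr0n|exact: harmonic_gt0].
have gf x : g N x @[N --> \oo] --> f x.
  apply/cvgrPdist_le => e e0; near=> N.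
  have [_ _ gN] := gP N.
  rewrite distrC; apply: le_trans (gN _ _) _.
    move=> j; apply: le_trans (coord_le_norm _ _) _.
    apply: (@le_trans _ _ N%:R); last by rewrite ler_nat.
    by near: N; exact: nbhs_infty_ger.
  near: N.
  have /cvgrPdist_le/(_ _ e0) := @cvg_harmonic R.
  apply: filterS => N; rewrite sub0r normrN; apply: le_trans; exact: ler_norm.
(* The Gaussian side asks for no tail estimate: the common bound [M] allows dominated
   convergence. *)
have Gg : gauss_mean A (g N) @[N --> \oo] --> gauss_mean A f.
  apply: ((gauss_iter_dominated p).2 _ _ M) => [N||N v|v].
  - by apply: seq_continuous_mulmx; apply: trigpoly_continuous; have [] := gP N.
  - exact: seq_continuous_mulmx.
  - by have [_ + _] := gP N; exact.
  - exact: gf.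
apply/cvgrPdist_le => e e0.
have e40 : 0 < e / 4 by rewrite divr_gt0.
(* Outside the box the approximation error is at most [2 M], so this tail probability makes its
   contribution at most [e / 4]; the [+ 1] covers [M = 0]. *)
have eM0 : 0 < e / (4 * (2 * M + 1)) by rewrite divr_gt0// mulr_gt0// ltr_pwDr// mulr_ge0.
have [L tL] := tight _ eM0.
(* [N] is fixed before [n], because convergence of means is known for one trigonometric polynomial
   at a time. The budget is [e / 4] for the Gaussian means, [e / 4] for that convergence, and
   [e / 4] each inside and outside the box. *)
near \oo => N.
have [tg bg gN] := gP N.
have gNf : `|gauss_mean A (g N) - gauss_mean A f| <= e / 4.
  by near: N; move/cvgrPdist_le: Gg => /(_ _ e40); apply: filterS => N; rewrite distrC.
have hN : harmonic N <= e / 4 :> R.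
  near: N; have /cvgrPdist_le/(_ _ e40) := @cvg_harmonic R.
  apply: filterS => N; rewrite sub0r normrN; apply: le_trans; exact: ler_norm.
have LN : L <= N.+1%:R.
  apply: (@le_trans _ _ N%:R); last by rewrite ler_nat.
  by near: N; exact: nbhs_infty_ger.
have /cvgrPdist_le/(_ _ e40) nE := trigpoly_mean_cvg mZ Zc tg.
near=> n.
have Ig := bounded_integrable (measurable_trigpoly (mZ n) tg) (fun w => bg (Z n w)).
have h1 : `|\int[P]_w g N (Z n w) - gauss_mean A (g N)| <= e / 4.
  by rewrite distrC; near: n; exact: nE.
have Pn : (P [set w | (L < `|Z n w|)%R] <= (e / (4 * (2 * M + 1)))%:E)%E.
  by near: n; exact: tL.
have h2 : `|\int[P]_w f (Z n w) - \int[P]_w g N (Z n w)| <= e / 4 + e / 4.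
  rewrite -(RintegralB measurableT (If n) Ig).
  have mB := measurable_norm_gt L (mZ n).
  set B := [set w | _] in Pn mB.
  have IB := integrable_indic P mB.
  have I1 : P.-integrable setT (EFin \o cst (e / 4)) by exact: finite_measure_integrable_cst.
  have I2 := integrableZl measurableT (2 * M) IB.
  have IfB : P.-integrable setT (EFin \o (fun w => e / 4 + 2 * M * \1_B w)).
    exact: (integrableD measurableT I1 I2).
  apply: le_trans (le_normr_Rintegral measurableT _) _; first exact: (integrableB measurableT (If n) Ig).
  apply: le_trans (le_Rintegral measurableT _ IfB _) _.
  - exact/(@integrable_norm _ _ _ P setT)/(integrableB measurableT (If n) Ig).
  - move=> w _ /=; rewrite indicE; have [wB|wB] := boolP (w \in B).
      apply: le_trans (ler_normB _ _) _.
      by have := bf (Z n w); have := bg (Z n w); rewrite mulr1; lra.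
    rewrite mulr0 addr0 distrC; apply: le_trans (gN _ _) hN.
    move=> j; apply: le_trans (coord_le_norm _ _) _; apply: le_trans LN.
    by move: wB; rewrite notin_setE /B/= => /negP; rewrite -leNgt.
  rewrite (RintegralD measurableT I1 I2).
  rewrite [X in X + _]mean_cst RintegralZl// lerD2l.
  rewrite /Rintegral integral_indic// setIT.
  have PB : fine (P B) <= e / (4 * (2 * M + 1)).
    by rewrite -lee_fin fineK// fin_num_measure.
  apply: le_trans (ler_wpM2l _ PB) _; first by rewrite mulr_ge0.
  have -> : 2 * M * (e / (4 * (2 * M + 1))) = e / 4 * (2 * M / (2 * M + 1)).
    by field; rewrite gt_eqF// ltr_pwDr// mulr_ge0.
  rewrite ler_piMr ?(ltW e40)// ler_pdivrMr ?mul1r ?lerDl// ltr_pwDr// mulr_ge0//.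
rewrite /=; have := ler_distD (\int[P]_w g N (Z n w)) (\int[P]_w f (Z n w)) (gauss_mean A f).
have := ler_distD (gauss_mean A (g N)) (\int[P]_w g N (Z n w)) (gauss_mean A f).
rewrite (distrC (gauss_mean A f)).
lra.
Unshelve. all: by end_near. Qed.

End Levy.

(** * A central limit theorem for weighted sums *)

Section Independence.
Context {R : realType} {d : measure_display} {T : measurableType d}
  (P : probability T R).
Implicit Types (W h : T -> R) (u v : R -> R) (C K : R).

Lemma mean_norm_le h K : measurable_fun setT h -> (forall w, `|h w| <= K) ->
  `|\int[P]_w h w| <= K.
Proof.
move=> mh hK; have ih := bounded_integrable P mh hK.
apply: le_trans (le_normr_Rintegral measurableT ih) _.
rewrite -[leRHS](mean_cst P).
apply: le_Rintegral => //; first exact: integrable_norm.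
exact: finite_measure_integrable_cst.
Qed.

(* The covariance of [W] and [u X] is linear in [u] and vanishes on indicators; writing
   [u = (1_D + u') / 2] with [D = {u >= 1/2}] and [u' in [0, 1]] halves it, so it is [0]. *)
Lemma mean_mul_of_indic W (X : T -> R) C v K :
  measurable_fun setT W -> (forall w, `|W w| <= C) -> measurable_fun setT X ->
  (forall B, measurable B ->
     \int[P]_w (W w * \1_B (X w)) = \int[P]_w W w * \int[P]_w \1_B (X w)) ->
  measurable_fun setT v -> (forall x, `|v x| <= K) ->
  \int[P]_w (W w * v (X w)) = \int[P]_w W w * \int[P]_w v (X w).
Proof.
move=> mW bW mX WB mv bv.
have C0 : 0 <= C by apply: le_trans (bW point).
have iW := bounded_integrable P mW bW.
have mc u : measurable_fun setT u -> measurable_fun setT (u \o X).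
  by move=> mu; exact: measurableT_comp.
have iu u (L : R) : measurable_fun setT u -> (forall x, `|u x| <= L) ->
    P.-integrable setT (EFin \o (u \o X)).
  by move=> mu bu; apply: (bounded_integrable P (mc u mu) (fun w => bu (X w))).
have iWu u (L : R) : measurable_fun setT u -> (forall x, `|u x| <= L) ->
    P.-integrable setT (EFin \o (fun w => W w * u (X w))).
  move=> mu bu; apply: (bounded_integrable P (M := C * L)).
    by apply: measurable_funM => //; exact: mc.
  by move=> w; rewrite normrM ler_pM.
pose err u := \int[P]_w (W w * u (X w)) - \int[P]_w W w * \int[P]_w u (X w).
have err_lin a b u1 u2 (L1 L2 : R) : measurable_fun setT u1 -> measurable_fun setT u2 ->
    (forall x, `|u1 x| <= L1) -> (forall x, `|u2 x| <= L2) ->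
    err (fun x => a * u1 x + b * u2 x) = a * err u1 + b * err u2.
  move=> m1 m2 b1 b2; rewrite /err.
  have -> : (fun w => W w * (a * u1 (X w) + b * u2 (X w))) =
      (fun w => a * (W w * u1 (X w)) + b * (W w * u2 (X w))).
    by apply/funext => w; ring.
  have j1 := iWu _ _ m1 b1; have j2 := iWu _ _ m2 b2.
  have k1 := iu _ _ m1 b1; have k2 := iu _ _ m2 b2.
  rewrite (RintegralD measurableT (integrableZl measurableT a j1) (integrableZl measurableT b j2)).
  rewrite (RintegralD measurableT (integrableZl measurableT a k1) (integrableZl measurableT b k2)).
  rewrite !(RintegralZl _ measurableT j1, RintegralZl _ measurableT j2).
  rewrite !(RintegralZl _ measurableT k1, RintegralZl _ measurableT k2).
  by ring.
have halving n u : measurable_fun setT u -> (forall x, 0 <= u x <= 1) ->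
    `|err u| <= 2 * C / 2 ^+ n.
  elim: n u => [|n IH] u mu u01.
    have bu x : `|u x| <= 1 by have /andP[u0 u1] := u01 x; rewrite ger0_norm.
    rewrite expr0 divr1 /err; apply: le_trans (ler_normB _ _) _.
    have h1 : `|\int[P]_w (W w * u (X w))| <= C.
      apply: mean_norm_le; first by apply: measurable_funM => //; exact: mc.
      by move=> w; rewrite normrM -[leRHS]mulr1 ler_pM.
    have h2 : `|\int[P]_w W w| <= C by exact: mean_norm_le.
    have h3 : `|\int[P]_w u (X w)| <= 1.
      by apply: mean_norm_le; [exact: mc|move=> w; exact: bu].
    rewrite normrM.
    have h4 : `|\int[P]_w W w| * `|\int[P]_w u (X w)| <= C * 1 by exact: ler_pM.
    by lra.
  pose D := [set x | 2^-1 <= u x].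
  have mD : measurable D.
    have := mu measurableT _ (measurable_itv `[2^-1, +oo[); rewrite setTI.
    suff -> : D = u @^-1` `[2^-1, +oo[ by [].
    by apply/seteqP; split => w /=; rewrite in_itv/= andbT.
  have m1 : measurable_fun setT (\1_D : R -> R) by exact: measurable_indic.
  pose u' x := 2 * u x - \1_D x.
  have mu' : measurable_fun setT u' by apply: measurable_funB => //; exact: measurable_funM.
  have u'01 x : 0 <= u' x <= 1.
    rewrite /u' indicE; have /andP[u0 u1] := u01 x.
    have [xD|xD] := boolP (x \in D).
      by move: xD; rewrite inE /D/= => xD; apply/andP; split; lra.
    move: xD; rewrite notin_setE /D/= => /negP; rewrite -ltNge => xD.
    by apply/andP; split; lra.
  have b1 x : `|(\1_D : R -> R) x| <= 1 by rewrite indicE; case: (_ \in _); rewrite ?normr1 ?normr0.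
  have bu' x : `|u' x| <= 1 by have /andP[u0 u1] := u'01 x; rewrite ger0_norm.
  have -> : u = (fun x => 2^-1 * u' x + 2^-1 * \1_D x).
    by apply/funext => x; rewrite /u'; field.
  rewrite (err_lin _ _ _ _ 1 1)//.
  have -> : err \1_D = 0 by rewrite /err WB// subrr.
  rewrite mulr0 addr0 normrM ger0_norm// exprS invfM.
  have := IH _ mu' u'01.
  by move: (`|err u'|) => y; set z := 2 ^- n; lra.
have err0 u : measurable_fun setT u -> (forall x, 0 <= u x <= 1) -> err u = 0.
  move=> mu u01; apply/eqP; rewrite -normr_le0; apply/ler_addgt0Pr => e e0; rewrite add0r.
  have [n hn] : exists n : nat, 2 * C / 2 ^+ n <= e.
    have /cvgrPdist_le/(_ _ e0)[n _ /(_ n (leqnn n))] :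
        (fun n => 2 * C * (2^-1) ^+ n) @ \oo --> (0 : R).
      rewrite -[X in _ --> X](mulr0 (2 * C)); apply: cvgM; first exact: cvg_cst.
      by apply: cvg_expr; rewrite ger0_norm; lra.
    rewrite /= sub0r normrN => h; exists n; apply: le_trans h.
    by rewrite exprVn ler_norm.
  exact: le_trans (halving n u mu u01) hn.
pose K' := `|K| + 1.
have K'0 : 0 < K' by rewrite ltr_pwDr.
pose u x := (v x / K' + 1) / 2.
have mu : measurable_fun setT u.
  by apply: measurable_funM => //; apply: measurable_funD => //; exact: measurable_funM.
have u01 x : 0 <= u x <= 1.
  have : `|v x / K'| <= 1.
    rewrite normrM [`|K'^-1|]gtr0_norm ?invr_gt0// ler_pdivrMr// mul1r.
    by apply: le_trans (bv x) _; rewrite (le_trans (ler_norm _))// lerDl.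
  by rewrite ler_norml /u => /andP[h1 h2]; apply/andP; split; lra.
have : err v = 0.
  have -> : v = (fun x => (2 * K') * u x + (- K') * cst 1 x).
    by apply/funext => x; rewrite /u /=; field; rewrite gt_eqF.
  have bu x : `|u x| <= 1 by have /andP[u0 u1] := u01 x; rewrite ger0_norm.
  rewrite (err_lin _ _ _ _ 1 1)//; last by move=> x /=; rewrite normr1.
  by rewrite !err0//; [ring|move=> x /=; rewrite ler01 lexx].
by move=> /eqP; rewrite subr_eq0 => /eqP.
Qed.

Context (X : nat -> T -> R).
Context (mX : forall i, measurable_fun setT (X i)).
Context (indX : mutually_independent P X).

Lemma prod_indic (s : seq nat) (B : nat -> set R) w :
  \prod_(i <- s) (\1_(B i) (X i w) : R) =
  \1_(\big[setI/setT]_(i <- s) (X i @^-1` B i)) w.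
Proof.
elim: s => [|i s IH]; first by rewrite !big_nil indicT.
by rewrite !big_cons IH indicI.
Qed.

Lemma measurable_prod_RV (v : nat -> R -> R) (s : seq nat) (Q : pred nat) :
  (forall i, measurable_fun setT (v i)) ->
  measurable_fun setT (fun w => \prod_(i <- s | Q i) v i (X i w)).
Proof.
move=> mv; elim: s => [|i s IH].
  by under eq_fun do rewrite big_nil; exact: measurable_cst.
case Qi : (Q i); under eq_fun do rewrite big_cons Qi; last exact: IH.
by apply: measurable_funM => //; exact: measurableT_comp.
Qed.

Lemma bounded_prod_RV (v : nat -> R -> R) (s : seq nat) (Q : pred nat) :
  (forall i, exists K, forall x, `|v i x| <= K) ->
  exists K, forall w, `|\prod_(i <- s | Q i) v i (X i w)| <= K.
Proof.
move=> /choice[K bv]; exists (\prod_(i <- s | Q i) K i) => w.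
by rewrite normr_prod; apply: ler_prod => i _; rewrite normr_ge0/=.
Qed.

(** [t] lists the indices whose factor may be any bounded measurable function; the others are
    indicators. For empty [t] this is the definition of independence. Adding [j] to [t] is
    [mean_mul_of_indic], with [W] the product of the other factors. *)
Lemma mean_prod_aux (t s : seq nat) (v : nat -> R -> R) : uniq s ->
  (forall i, measurable_fun setT (v i)) ->
  (forall i, exists K, forall x, `|v i x| <= K) ->
  (forall i, i \in s -> i \notin t -> exists2 B, measurable B & v i = \1_B) ->
  \int[P]_w \prod_(i <- s) v i (X i w) = \prod_(i <- s) \int[P]_w v i (X i w).
Proof.
move=> us; elim: t v => [|j t IH] v mv bv vI.
  have /choice[B BP] i : exists B, measurable B /\ (i \in s -> v i = \1_B).
    have [si|si] := boolP (i \in s); last by exists setT.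
    by have [B mB vB] := vI i si isT; exists B.
  have mXB i : measurable (X i @^-1` B i) by rewrite -[X in measurable X]setTI; exact: mX (BP i).1.
  have -> : (fun w => \prod_(i <- s) v i (X i w)) =
      \1_(\big[setI/setT]_(i <- s) (X i @^-1` B i)).
    apply/funext => w; rewrite -prod_indic big_seq [RHS]big_seq.
    by apply: eq_bigr => i si; rewrite (BP i).2.
  have mI : measurable (\big[setI/setT]_(i <- s) (X i @^-1` B i)).
    by elim: (s) => [|i s' IHs]; rewrite ?big_nil// big_cons; exact: measurableI.
  rewrite /Rintegral integral_indic// setIT.
  apply: etrans (congr1 fine (indX us (fun i => (BP i).1))) _.
  have prod_fine (A : nat -> set T) (r : seq nat) : (forall i, measurable (A i)) ->
      (\prod_(i <- r) P (A i) = (\prod_(i <- r) fine (P (A i)))%:E)%E.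
    move=> mA; elim: r => [|i r IHr]; first by rewrite !big_nil.
    by rewrite !big_cons IHr EFinM fineK// fin_num_measure.
  rewrite prod_fine//= big_seq [RHS]big_seq; apply: eq_bigr => i si.
  rewrite (BP i).2// (_ : (fun w => _) = (fun w => (\1_(X i @^-1` B i) w)%:E))//.
  by rewrite integral_indic// setIT.
have [js|js] := boolP (j \in s); last first.
  apply: IH => // i si it; apply: vI => //; rewrite in_cons negb_or it andbT.
  by apply: contraNneq js => <-.
pose W w := \prod_(i <- s | i != j) v i (X i w).
have mW : measurable_fun setT W by exact: measurable_prod_RV.
have [C bW] := bounded_prod_RV s (fun i => i != j) bv.
have step B : measurable B -> \int[P]_w (W w * \1_B (X j w)) =
    (\prod_(i <- s | i != j) \int[P]_w v i (X i w)) * \int[P]_w \1_B (X j w).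
  move=> mB; pose v' i := if i == j then \1_B : R -> R else v i.
  have mv' i : measurable_fun setT (v' i) by rewrite /v'; case: ifP => // _; exact: measurable_indic.
  have bv' i : exists K, forall x, `|v' i x| <= K.
    rewrite /v'; case: ifP => // _; exists 1 => x.
    by rewrite indicE; case: (_ \in _); rewrite ?normr1 ?normr0.
  have v'j : v' j = \1_B by rewrite /v' eqxx.
  have v'i i : i != j -> v' i = v i by rewrite /v' => /negbTE ->.
  have H : \int[P]_w \prod_(i <- s) v' i (X i w) = \prod_(i <- s) \int[P]_w v' i (X i w).
    apply: IH => // i si it.
    have [->|ij] := eqVneq i j; first by exists B.
    by rewrite v'i//; apply: vI => //; rewrite in_cons negb_or ij.
  rewrite [RHS](bigD1_seq j js us)/= v'j in H.
  rewrite mulrC -[X in _ * X](eq_bigr _ (fun i ij => congr1 (fun u => \int[P]_w u (X i w)) (v'i i ij))).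
  rewrite -H; apply: eq_Rintegral => w _.
  rewrite [RHS](bigD1_seq j js us)/= v'j mulrC; congr (_ * _).
  by apply: eq_bigr => i ij; rewrite v'i.
(* Taking [B = setT] in [step] makes the factor at [j] equal to 1. *)
have EW : \int[P]_w W w = \prod_(i <- s | i != j) \int[P]_w v i (X i w).
  have := step setT measurableT.
  by under eq_Rintegral do rewrite indicT mulr1; under [X in _ * X]eq_Rintegral do rewrite indicT; rewrite mean_cst mulr1.
have [K bvj] := bv j.
have := mean_mul_of_indic mW bW (mX j) _ (mv j) bvj.
rewrite EW => /(_ step) e.
rewrite (bigD1_seq j)//= mulrC -e.
by apply: eq_Rintegral => w _; rewrite (bigD1_seq j)//= mulrC.
Qed.

Lemma mean_prod (s : seq nat) (v : nat -> R -> R) : uniq s ->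
  (forall i, measurable_fun setT (v i)) ->
  (forall i, exists K, forall x, `|v i x| <= K) ->
  \int[P]_w \prod_(i <- s) v i (X i w) = \prod_(i <- s) \int[P]_w v i (X i w).
Proof. by move=> us mv bv; apply: (@mean_prod_aux s) => // i ->. Qed.

Definition lin_comb (c : nat -> R) m w := \sum_(i < m) c i * X i w.

Lemma measurable_lin_comb c m : measurable_fun setT (lin_comb c m).
Proof. by apply: measurable_sum => i; exact: measurable_funM. Qed.

Lemma measurable_comp_affine (f : R -> R) (Y : T -> R) th : continuous f ->
  measurable_fun setT Y -> measurable_fun setT (fun w => f (Y w + th)).
Proof.
move=> cf mY; apply: (measurableT_comp (continuous_measurable_fun cf)).
exact: measurable_funD.
Qed.

Lemma measurable_cosM (a : R) : measurable_fun setT (fun x : R => cos (a * x)).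
Proof.
apply: (measurableT_comp (continuous_measurable_fun (@continuous_cos R))).
exact: measurable_funM.
Qed.

Lemma measurable_sinM (a : R) : measurable_fun setT (fun x : R => sin (a * x)).
Proof.
apply: (measurableT_comp (continuous_measurable_fun (@continuous_sin R))).
exact: measurable_funM.
Qed.

(** The extra product over later indices is what the induction needs: the addition formula removes
    [X m] from the sum and leaves [cos (c m * X m)] or [sin (c m * X m)] as one more such factor. *)
Lemma mean_cos_prod c m th (s : seq nat) (v : nat -> R -> R) : uniq s ->
  (forall i, i \in s -> (m <= i)%N) ->
  (forall i, measurable_fun setT (v i)) ->
  (forall i, exists K, forall x, `|v i x| <= K) ->
  \int[P]_w (cos (lin_comb c m w + th) * \prod_(i <- s) v i (X i w)) =
  \int[P]_w cos (lin_comb c m w + th) * \prod_(i <- s) \int[P]_w v i (X i w).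
Proof.
elim: m th s v => [|m IH] th s v us sm mv bv.
  have lc0 w : lin_comb c 0 w = 0 by rewrite /lin_comb big_ord0.
  under eq_Rintegral do rewrite lc0.
  under [in RHS]eq_Rintegral do rewrite lc0.
  have [K bK] := bounded_prod_RV s predT bv.
  rewrite mean_cst -mean_prod// RintegralZl//.
  by apply: (bounded_integrable P _ bK); exact: measurable_prod_RV.
have ms : m \notin s by apply/negP => /sm; rewrite ltnn.
have ums : uniq (m :: s) by rewrite /= ms.
have msm i : i \in m :: s -> (m <= i)%N.
  by rewrite in_cons => /orP[/eqP->//|/sm/ltnW].
have um : uniq [:: m] by [].
have mm i : i \in [:: m] -> (m <= i)%N by rewrite inE => /eqP->.
pose vc i := if i == m then fun x => cos (c m * x) else v i.
pose vs i := if i == m then fun x => sin (c m * x) else v i.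
have mvc i : measurable_fun setT (vc i) by rewrite /vc; case: ifP => // _; exact: measurable_cosM.
have mvs i : measurable_fun setT (vs i) by rewrite /vs; case: ifP => // _; exact: measurable_sinM.
have bvc i : exists K, forall x, `|vc i x| <= K.
  by rewrite /vc; case: ifP => // _; exists 1 => x; exact: cos_max.
have bvs i : exists K, forall x, `|vs i x| <= K.
  by rewrite /vs; case: ifP => // _; exists 1 => x; exact: sin_max.
have vcs w : \prod_(i <- s) vc i (X i w) = \prod_(i <- s) v i (X i w).
  by rewrite !big_seq; apply: eq_bigr => i si; rewrite /vc; case: eqP si ms => // -> ->.
have vss w : \prod_(i <- s) vs i (X i w) = \prod_(i <- s) v i (X i w).
  by rewrite !big_seq; apply: eq_bigr => i si; rewrite /vs; case: eqP si ms => // -> ->.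
have Ecs : \prod_(i <- s) \int[P]_w vc i (X i w) = \prod_(i <- s) \int[P]_w v i (X i w).
  by rewrite !big_seq; apply: eq_bigr => i si; rewrite /vc; case: eqP si ms => // -> ->.
have Ess : \prod_(i <- s) \int[P]_w vs i (X i w) = \prod_(i <- s) \int[P]_w v i (X i w).
  by rewrite !big_seq; apply: eq_bigr => i si; rewrite /vs; case: eqP si ms => // -> ->.
have expand w : cos (lin_comb c m.+1 w + th) =
    cos (lin_comb c m w + th) * vc m (X m w) + cos (lin_comb c m w + (th + pi / 2)) * vs m (X m w).
  rewrite /vc /vs eqxx /lin_comb big_ord_recr/= addrA cosDpihalf addrAC cosD.
  by rewrite mulNr.
have mcos th' : measurable_fun setT (fun w => cos (lin_comb c m w + th')).
  by apply: measurable_comp_affine; [exact: continuous_cos|exact: measurable_lin_comb].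
have integ (r : seq nat) (u : nat -> R -> R) th' : (forall i, measurable_fun setT (u i)) ->
    (forall i, exists K, forall x, `|u i x| <= K) ->
    P.-integrable setT (EFin \o (fun w => cos (lin_comb c m w + th') * \prod_(i <- r) u i (X i w))).
  move=> mu bu; have [K bK] := bounded_prod_RV r predT bu.
  apply: (bounded_integrable P (M := 1 * K)).
    by apply: measurable_funM => //; exact: measurable_prod_RV.
  by move=> w; rewrite normrM ler_pM// cos_max.
have -> : (fun w => cos (lin_comb c m.+1 w + th) * \prod_(i <- s) v i (X i w)) =
    (fun w => cos (lin_comb c m w + th) * \prod_(i <- m :: s) vc i (X i w) +
       cos (lin_comb c m w + (th + pi / 2)) * \prod_(i <- m :: s) vs i (X i w)).
  by apply/funext => w; rewrite expand !big_cons vcs vss; ring.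
have -> : (fun w => cos (lin_comb c m.+1 w + th)) =
    (fun w => cos (lin_comb c m w + th) * \prod_(i <- [:: m]) vc i (X i w) +
       cos (lin_comb c m w + (th + pi / 2)) * \prod_(i <- [:: m]) vs i (X i w)).
  by apply/funext => w; rewrite expand !big_seq1.
rewrite !(RintegralD measurableT (integ _ _ _ mvc bvc) (integ _ _ _ mvs bvs)).
rewrite (IH _ _ _ ums msm mvc bvc) (IH _ _ _ ums msm mvs bvs).
rewrite (IH _ _ _ um mm mvc bvc) (IH _ _ _ um mm mvs bvs).
by rewrite !big_cons !big_nil Ecs Ess; ring.
Qed.

Lemma mean_cosS c m th :
  \int[P]_w cos (lin_comb c m.+1 w + th) =
  \int[P]_w cos (lin_comb c m w + th) * \int[P]_w cos (c m * X m w) +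
  \int[P]_w cos (lin_comb c m w + (th + pi / 2)) * \int[P]_w sin (c m * X m w).
Proof.
have um : uniq [:: m] by [].
have mm i : i \in [:: m] -> (m <= i)%N by rewrite inE => /eqP->.
have b1 (i : nat) : exists K, forall x : R, `|cos (c m * x)| <= K by exists 1 => x; exact: cos_max.
have b2 (i : nat) : exists K, forall x : R, `|sin (c m * x)| <= K by exists 1 => x; exact: sin_max.
have := mean_cos_prod c th um mm (fun=> measurable_cosM (c m)) b1.
have := mean_cos_prod c (th + pi / 2) um mm (fun=> measurable_sinM (c m)) b2.
rewrite !big_seq1 => <- <-.
have E (f : R -> R) th' : \int[P]_w (cos (lin_comb c m w + th') * \prod_(i <- [:: m]) f (c m * X i w)) =
    \int[P]_w (cos (lin_comb c m w + th') * f (c m * X m w)).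
  by apply: eq_Rintegral => w _; rewrite big_seq1.
rewrite (E cos) (E sin).
have mcos th' : measurable_fun setT (fun w => cos (lin_comb c m w + th')).
  by apply: measurable_comp_affine; [exact: continuous_cos|exact: measurable_lin_comb].
rewrite -RintegralD//.
- by apply: eq_Rintegral => w _; rewrite /lin_comb big_ord_recr/= addrA cosDpihalf addrAC cosD mulNr.
- apply: (bounded_integrable P (M := 1 * 1)).
    by apply: measurable_funM => //; exact: (measurableT_comp (measurable_cosM _)).
  by move=> w; rewrite normrM ler_pM// cos_max.
- apply: (bounded_integrable P (M := 1 * 1)).
    by apply: measurable_funM => //; exact: (measurableT_comp (measurable_sinM _)).
  by move=> w; rewrite normrM ler_pM// ?cos_max// sin_max.
Qed.

(** The new error is [e m] times the old one plus the local error at [m] weighted by means of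
    cosines. All these multipliers are at most 1 in absolute value, so the local errors simply
    add. *)
Lemma mean_cos_telescope (c e r : nat -> R) m th :
  (forall i, 0 <= e i <= 1) ->
  (forall i, `|\int[P]_w cos (c i * X i w) - e i| + `|\int[P]_w sin (c i * X i w)| <= r i) ->
  `|\int[P]_w cos (lin_comb c m w + th) - (\prod_(i < m) e i) * cos th| <= \sum_(i < m) r i.
Proof.
move=> e01 er; elim: m th => [|m IH] th.
  rewrite !big_ord0 mul1r.
  under eq_Rintegral do rewrite /lin_comb big_ord0 add0r.
  by rewrite mean_cst subrr normr0.
have H1 th' : `|\int[P]_w cos (lin_comb c m w + th')| <= 1.
  apply: mean_norm_le => [|w]; last exact: cos_max.
  by apply: measurable_comp_affine; [exact: continuous_cos|exact: measurable_lin_comb].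
rewrite mean_cosS !big_ord_recr/=.
set H := \int[P]_w cos (lin_comb c m w + th); set H' := \int[P]_w cos (_ + (_ + _)).
set a := \int[P]_w cos (c m * _); set b := \int[P]_w sin _.
have -> : H * a + H' * b - (\prod_(i < m) e i) * e m * cos th =
    e m * (H - (\prod_(i < m) e i) * cos th) + (H * (a - e m) + H' * b) by ring.
apply: le_trans (ler_normD _ _) _; apply: lerD.
  have /andP[e0 e1] := e01 m.
  by rewrite normrM (ger0_norm e0) -[leRHS]mul1r ler_pM// IH.
apply: le_trans (ler_normD _ _) _; apply: le_trans (er m).
by rewrite !normrM; apply: lerD; rewrite -[leRHS]mul1r ler_pM// H1.
Qed.

End Independence.

(** * Characteristic functions and second moments of weighted i.i.d. sums *)

Section CharacteristicFunctionCLT.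
Context {R : realType} {d : measure_display} {T : measurableType d}
  (P : probability T R).

Lemma mean_dominated_cvg (h_ : nat -> T -> R) (h g : T -> R) :
  (forall n, measurable_fun setT (h_ n)) ->
  (forall w, h_ n w @[n --> \oo] --> h w) ->
  P.-integrable setT (EFin \o g) -> (forall n w, `|h_ n w| <= g w) ->
  \int[P]_w h_ n w @[n --> \oo] --> \int[P]_w h w.
Proof.
move=> mh hh ig hg.
have mh' : measurable_fun setT h by apply: (measurable_fun_cvg (h := h_)) => // w _; exact: hh.
have hg' w : `|h w| <= g w.
  by apply: (ler_cvg_to (cvg_norm (hh w)) (cvg_cst (g w))); exact: nearW.
have ih : P.-integrable setT (EFin \o h).
  apply: le_integrable ig => //; first exact/measurable_EFinP.
  by move=> w _ /=; rewrite lee_fin (le_trans (hg' w))// ler_norm.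
apply: fine_cvg; rewrite fineK; last exact: (integrable_fin_num measurableT ih).
apply: (@dominated_cvg _ _ _ P setT measurableT _ _ (EFin \o g)) => //.
- by move=> n; exact/measurable_EFinP.
- by move=> w _; apply: cvg_EFin; [exact: nearW|exact: hh].
- by move=> n w _; rewrite /= lee_fin.
Qed.

Context (X : nat -> {RV P >-> R}) (sigma : R).
Context (indX : mutually_independent P (fun i => X i)).
Context (idX : identically_distributed P (fun i => X i)).
Context (int0 : P.-integrable setT (EFin \o X 0%N)).
Context (mean0 : 'E_P[X 0%N]%E = 0%E).
Context (var0 : 'V_P[X 0%N]%E = (sigma ^+ 2)%:E).

Let mX i : measurable_fun setT (X i).
Proof. exact: measurable_funP. Qed.

Lemma iid_transfer (g : R -> R) i : measurable_fun setT g ->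
  P.-integrable setT (EFin \o (g \o X 0%N)) ->
  P.-integrable setT (EFin \o (g \o X i)) /\
  \int[P]_w g (X i w) = \int[P]_w g (X 0%N w).
Proof.
move=> mg ig.
have eqd (f : R -> \bar R) :
    (\int[distribution P (X i)]_y f y = \int[distribution P (X 0%N)]_y f y)%E.
  by apply: eq_measure_integral => A mA _; exact: idX.
have mgE : measurable_fun setT (EFin \o g) by exact/measurable_EFinP.
have ii : P.-integrable setT (EFin \o (g \o X i)).
  apply/integrableP; split; first by apply/measurable_EFinP; exact: measurableT_comp.
  have /integrableP[_] := ig.
  have mag : measurable_fun setT (abse \o (EFin \o g)) by exact: measurableT_comp.
  have <- := ge0_integral_distribution (X 0%N) mag (fun=> abse_ge0 _).
  by rewrite -eqd ge0_integral_distribution//; move=> y; exact: abse_ge0.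
split=> //; rewrite /Rintegral; congr fine.
have <- := integral_distribution mgE ii.
by rewrite eqd integral_distribution.
Qed.

(** With mean zero the variance is the integral of the square, and for a nonnegative function a
    finite integral is integrability. *)
Lemma RV_sqr_moment : P.-integrable setT (EFin \o (fun w => X 0%N w ^+ 2)) /\
  \int[P]_w (X 0%N w ^+ 2) = sigma ^+ 2.
Proof.
have E : (\int[P]_w (X 0%N w ^+ 2)%:E = (sigma ^+ 2)%:E)%E.
  rewrite -var0 /variance covariance.unlock mean0 /= expectation.unlock.
  apply: eq_integral => w _; congr EFin.
  by rewrite -[RHS]/((X 0%N w - 0) * (X 0%N w - 0)) subr0 expr2.
split; last by rewrite /Rintegral E.
apply/integrableP; split; first by apply/measurable_EFinP; exact: measurable_funX.
rewrite (eq_integral (fun w => (X 0%N w ^+ 2)%:E)); first by rewrite E ltry.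
by move=> w _; rewrite /= ger0_norm ?sqr_ge0.
Qed.

Lemma RV_mean0 : \int[P]_w X 0%N w = 0.
Proof. by rewrite /Rintegral; move: mean0; rewrite expectation.unlock => ->. Qed.

(** A soft form of Lindeberg's truncated second moment, matching [sin_remainder] and [cos_remainder]
    at [c X]. *)
Definition truncated_moment (c : R) := \int[P]_w (X 0%N w ^+ 2 * Num.min 1 `|c * X 0%N w|).

Lemma norm_min1 (x : R) : `|Num.min 1 `|x| | = Num.min 1 `|x|.
Proof. by rewrite ger0_norm// le_min ler01 normr_ge0. Qed.

Lemma truncated_moment_integrable c :
  P.-integrable setT (EFin \o (fun w => X 0%N w ^+ 2 * Num.min 1 `|c * X 0%N w|)).
Proof.
apply: le_integrable RV_sqr_moment.1 => //.
  apply/measurable_EFinP; apply: measurable_funM; first exact: measurable_funX.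
  by apply: measurable_minr => //; apply: measurableT_comp => //; exact: measurable_funM.
move=> w _; rewrite lee_fin normrM ler_piMr// norm_min1.
by rewrite ge_min lexx.
Qed.

(** Dominated convergence handles [c = 1 / (n + 1)]; monotonicity in [|c|] extends the bound to all
    small [c]. *)
Lemma truncated_moment_small (e : R) : 0 < e ->
  exists2 delta, 0 < delta & forall c, `|c| <= delta -> truncated_moment c <= e.
Proof.
move=> e0.
have : truncated_moment (harmonic n) @[n --> \oo] --> (0 : R).
  rewrite -(mean_cst P 0); apply: (mean_dominated_cvg (g := fun w => X 0%N w ^+ 2)) => [n|w||n w].
  - by have /measurable_int/measurable_EFinP := truncated_moment_integrable (harmonic n).
  - apply: norm_cvg0.
    have h : X 0%N w ^+ 2 * `|X 0%N w| * harmonic n @[n --> \oo] --> (0 : R).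
      rewrite -[X in _ --> X](mulr0 (X 0%N w ^+ 2 * `|X 0%N w|)).
      by apply: cvgM; [exact: cvg_cst|exact: cvg_harmonic].
    apply: (squeeze_cvgr _ (cvg_cst 0) h); apply: nearW => n; rewrite normr_ge0/=.
    rewrite normrM ger0_norm ?sqr_ge0// -mulrA ler_wpM2l ?sqr_ge0//.
    rewrite norm_min1 normrM [`|_^-1|]ger0_norm// mulrC.
    by rewrite ge_min lexx orbT.
  - exact: RV_sqr_moment.1.
  - rewrite normrM ger0_norm ?sqr_ge0// ler_piMr ?sqr_ge0// norm_min1.
    by rewrite ge_min lexx.
move=> /cvgrPdist_le/(_ _ e0)[n _ /(_ n (leqnn n))] /=; rewrite sub0r normrN => hn.
exists (harmonic n); first exact: harmonic_gt0.
move=> c cn; apply: le_trans (le_trans (ler_norm _) hn).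
apply: le_Rintegral => //; [exact: truncated_moment_integrable|exact: truncated_moment_integrable|].
move=> w _ /=; rewrite ler_wpM2l ?sqr_ge0// le_min ge_min lexx/= ge_min; apply/orP; right.
by rewrite !normrM ler_wpM2r// (ger0_norm (harmonic_ge0 _)).
Qed.

Lemma cf_local (e : R) : 0 < e -> exists2 delta, 0 < delta &
  forall c i, `|c| <= delta ->
  `|\int[P]_w cos (c * X i w) - expR (- (sigma ^+ 2 * c ^+ 2) / 2)| +
  `|\int[P]_w sin (c * X i w)| <= e * c ^+ 2.
Proof.
move=> e0.
(* The sine and cosine remainders are each at most [2 c^2 rho], hence [e c^2 / 4]; the exponential
   remainder costs another [e c^2 / 4]. *)
have e80 : 0 < e / 8 by rewrite divr_gt0.
have [d1 d10 trm] := truncated_moment_small e80.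
(* The aim is [sigma^4 c^2 <= e]. The cap at 1 in [d2] turns [|c| <= e / s4] into the same bound for
   [c^2]; the [+ 1] allows [sigma = 0]. *)
pose s4 := sigma ^+ 4 + 1.
have s40 : 0 < s4 by rewrite ltr_pwDr// -[4%N]/(2 * 2)%N exprM sqr_ge0.
pose d2 := Num.min 1 (e / s4).
have d20 : 0 < d2 by rewrite lt_min ltr01 divr_gt0.
exists (Num.min d1 d2); first by rewrite lt_min d10.
move=> c i; rewrite le_min => /andP[cd1 cd2].
have := trm _ cd1; set rho := truncated_moment c => rhoe.
have [iX2 EX2] := RV_sqr_moment.
have bc : forall w : T, `|cos (c * X 0%N w)| <= 1 by move=> w; exact: cos_max.
have bs : forall w : T, `|sin (c * X 0%N w)| <= 1 by move=> w; exact: sin_max.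
have ic := bounded_integrable P (measurableT_comp (measurable_cosM c) (mX 0)) bc.
have is_ := bounded_integrable P (measurableT_comp (measurable_sinM c) (mX 0)) bs.
have [_ ->] := iid_transfer i (measurable_cosM c) ic.
have [_ ->] := iid_transfer i (measurable_sinM c) is_.
have itr := truncated_moment_integrable c.
have i2tr := integrableZl measurableT (2 * c ^+ 2) itr.
have E2tr : \int[P]_w (2 * c ^+ 2 * (X 0%N w ^+ 2 * Num.min 1 `|c * X 0%N w|)) = 2 * c ^+ 2 * rho.
  by rewrite RintegralZl.
have S : `|\int[P]_w sin (c * X 0%N w)| <= 2 * c ^+ 2 * rho.
  have icX := integrableZl measurableT c int0.
  (* The mean is zero, so the linear term can be subtracted freely. *)
  have -> : \int[P]_w sin (c * X 0%N w) = \int[P]_w (sin (c * X 0%N w) - c * X 0%N w).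
    by rewrite (RintegralB measurableT is_ icX) RintegralZl// RV_mean0 mulr0 subr0.
  have iB := integrableB measurableT is_ icX.
  apply: le_trans (le_normr_Rintegral measurableT iB) _; rewrite -E2tr.
  apply: (le_Rintegral measurableT (integrable_norm iB) i2tr) => w _ /=.
  by apply: le_trans (sin_remainder _) _; rewrite exprMn !mulrA.
have C : `|\int[P]_w cos (c * X 0%N w) - 1 + sigma ^+ 2 * c ^+ 2 / 2| <= 2 * c ^+ 2 * rho.
  have i1 : P.-integrable setT (EFin \o cst (1 : R)) by exact: finite_measure_integrable_cst.
  have iq := integrableZl measurableT (c ^+ 2 / 2) iX2.
  have iB := integrableB measurableT ic i1.
  have iD := integrableD measurableT iB iq.
  have -> : \int[P]_w cos (c * X 0%N w) - 1 + sigma ^+ 2 * c ^+ 2 / 2 =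
      \int[P]_w (cos (c * X 0%N w) - 1 + c ^+ 2 / 2 * X 0%N w ^+ 2).
    rewrite (RintegralD measurableT iB iq) (RintegralB measurableT ic i1) RintegralZl//.
    by rewrite EX2 mean_cst; ring.
  apply: le_trans (le_normr_Rintegral measurableT iD) _; rewrite -E2tr.
  apply: (le_Rintegral measurableT (integrable_norm iD) i2tr) => w _ /=.
  have := cos_remainder (c * X 0%N w); rewrite exprMn.
  have -> : c ^+ 2 * X 0%N w ^+ 2 / 2 = c ^+ 2 / 2 * X 0%N w ^+ 2 by ring.
  by rewrite !mulrA.
have Ex : `|expR (- (sigma ^+ 2 * c ^+ 2) / 2) - 1 + sigma ^+ 2 * c ^+ 2 / 2| <= c ^+ 2 * (e / 4).
  set y := sigma ^+ 2 * c ^+ 2 / 2.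
  have y0 : 0 <= y by rewrite divr_ge0// mulr_ge0 ?sqr_ge0.
  rewrite mulNr -/y.
  have h1 := expR_ge1Dx (- y).
  (* From [exp y >= 1 + y] and [(1 + y) (1 - y + y^2) = 1 + y^3 >= 1]. *)
  have h2 : expR (- y) <= 1 - y + y ^+ 2.
    rewrite expRN; have h3 := expR_ge1Dx y.
    apply: (@le_trans _ _ (1 + y)^-1); first by rewrite lef_pV2 ?posrE ?expR_gt0//; lra.
    have y1 : 0 < 1 + y by lra.
    rewrite -[leLHS]mul1r ler_pdivrMr//.
    have : 0 <= y ^+ 3 by rewrite exprn_ge0.
    by rewrite !exprS expr0 mulr1; lra.
  rewrite ger0_norm; last by lra.
  apply: (@le_trans _ _ (y ^+ 2)); first by lra.
  have -> : y ^+ 2 = c ^+ 2 * (sigma ^+ 4 * c ^+ 2 / 4) by rewrite /y; field.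
  rewrite ler_wpM2l ?sqr_ge0// ler_wpM2r//.
  have c2 : c ^+ 2 <= e / s4.
    move: cd2; rewrite /d2 le_min => /andP[c1 ce].
    rewrite -real_normK ?num_real// expr2; apply: le_trans ce.
    by rewrite ler_piMr.
  have c20 : 0 <= c ^+ 2 by exact: sqr_ge0.
  apply: (@le_trans _ _ (s4 * c ^+ 2)).
    by rewrite ler_wpM2r// lerDl.
  by rewrite mulrC -ler_pdivlMr.
have := ler_normB (\int[P]_w cos (c * X 0%N w) - 1 + sigma ^+ 2 * c ^+ 2 / 2)
  (expR (- (sigma ^+ 2 * c ^+ 2) / 2) - 1 + sigma ^+ 2 * c ^+ 2 / 2).
have -> : \int[P]_w cos (c * X 0%N w) - 1 + sigma ^+ 2 * c ^+ 2 / 2 -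
   (expR (- (sigma ^+ 2 * c ^+ 2) / 2) - 1 + sigma ^+ 2 * c ^+ 2 / 2) =
   \int[P]_w cos (c * X 0%N w) - expR (- (sigma ^+ 2 * c ^+ 2) / 2) by ring.
have : 2 * c ^+ 2 * rho <= 2 * c ^+ 2 * (e / 8) by rewrite ler_wpM2l// mulr_ge0// sqr_ge0.
by have := mulr_ge0 (ltW e0) (sqr_ge0 c); lra.
Qed.

Lemma clt_cf (c : nat -> nat -> R) (v : R) :
  \sum_(i < n) c n i ^+ 2 @[n --> \oo] --> v ->
  (forall delta : R, 0 < delta -> \forall n \near \oo, forall i, (i < n)%N -> `|c n i| <= delta) ->
  forall th, \int[P]_w cos (lin_comb (fun i => X i) (c n) n w + th) @[n --> \oo] -->
    expR (- (sigma ^+ 2 * v) / 2) * cos th.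
Proof.
move=> cv cmax th.
pose ex n := expR (- (sigma ^+ 2 * \sum_(i < n) c n i ^+ 2) / 2) * cos th.
have exv : ex n @[n --> \oo] --> expR (- (sigma ^+ 2 * v) / 2) * cos th.
  apply: cvgM; last exact: cvg_cst.
  apply: (@cvg_comp _ _ _ _ expR _ _ _ _ (@continuous_expR R _)).
  apply: cvgM; last exact: cvg_cst.
  by apply: cvgN; apply: cvgM => //; exact: cvg_cst.
suff d0 : \int[P]_w cos (lin_comb (fun i => X i) (c n) n w + th) - ex n @[n --> \oo] --> (0 : R).
  rewrite -[X in _ --> X]add0r.
  have -> : (fun n => \int[P]_w cos (lin_comb (fun i => X i) (c n) n w + th)) =
      (fun n => (\int[P]_w cos (lin_comb (fun i => X i) (c n) n w + th) - ex n) + ex n).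
    by apply/funext => n; rewrite subrK.
  exact: cvgD.
apply/cvgrPdist_le => e e0.
have v0 : 0 <= v.
  by apply: (ler_cvg_to (cvg_cst 0) cv); apply: nearW => n; apply: sumr_ge0 => i _; exact: sqr_ge0.
(* The local errors sum to [e / (v + 1)] times the sum of squares, which is eventually at most
   [v + 1]. *)
have e1 : 0 < e / (v + 1) by rewrite divr_gt0// ltr_pwDr.
have [delta delta0 loc] := cf_local e1.
have /cvgrPdist_le/(_ _ ltr01) cv1 := cv.
near=> n.
rewrite sub0r normrN.
pose ee i := expR (- (sigma ^+ 2 * c n i ^+ 2) / 2).
have -> : ex n = (\prod_(i < n) ee i) * cos th.
  rewrite /ex mulr_sumr -sumrN mulr_suml expR_sum//.
have ee01 i : 0 <= ee i <= 1.
  rewrite expR_ge0/= -expR0 ler_expR mulNr oppr_le0 divr_ge0//.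
  by rewrite mulr_ge0 ?sqr_ge0.
apply: le_trans (mean_cos_telescope mX indX n th ee01 (fun i => lexx _)) _.
apply: (@le_trans _ _ (\sum_(i < n) e / (v + 1) * c n i ^+ 2)).
  apply: ler_sum => i _; apply: loc.
  have : forall i, (i < n)%N -> `|c n i| <= delta by near: n; exact: cmax.
  exact.
rewrite -mulr_sumr.
have : `|v - \sum_(i < n) c n i ^+ 2| <= 1 by near: n.
rewrite ler_norml => /andP[h _].
rewrite mulrAC ler_pdivrMr ?ltr_pwDr// ler_wpM2l ?(ltW e0)//.
by move: h; set S := \sum_(i < n) _; lra.
Unshelve. all: by end_near. Qed.

Lemma RV_integrable i : P.-integrable setT (EFin \o X i) /\ \int[P]_w X i w = 0.
Proof. by have [h1 h2] := iid_transfer i (@measurable_id _ _ setT) int0; rewrite h2 RV_mean0. Qed.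

Lemma RV_sqr_integrable i : P.-integrable setT (EFin \o (fun w => X i w ^+ 2)) /\
  \int[P]_w (X i w ^+ 2) = sigma ^+ 2.
Proof.
have [i0 E0] := RV_sqr_moment.
have m2 : measurable_fun setT (fun x : R => x ^+ 2) by exact: exprn_measurable.
by have [h1 h2] := iid_transfer i m2 i0; rewrite h2 E0.
Qed.

Lemma RV_mul_integrable i j : P.-integrable setT (EFin \o (fun w => X i w * X j w)).
Proof.
apply: le_integrable (integrableD measurableT (RV_sqr_integrable i).1 (RV_sqr_integrable j).1) => //.
  by apply/measurable_EFinP; exact: measurable_funM.
move=> w _ /=; rewrite lee_fin [leRHS]ger0_norm ?addr_ge0 ?sqr_ge0// normrM.
rewrite -(real_normK (num_real (X i w))) -(real_normK (num_real (X j w))).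
have := sqr_ge0 (`|X i w| - `|X j w|); have := sqr_ge0 (`|X i w| + `|X j w|).
by rewrite !expr2; nra.
Qed.

(** [mean_prod] concerns bounded functions, so both variables are truncated to [-n, n]. The
    truncated means tend to 0, and dominated convergence recovers the product. *)
Lemma RV_uncorrelated i j : i != j -> \int[P]_w (X i w * X j w) = 0.
Proof.
move=> ij.
pose tr (n : nat) (x : R) : R := x * \1_(`[- n%:R, n%:R]%classic) x.
have mtr n : measurable_fun setT (tr n).
  by apply: measurable_funM => //; apply: measurable_indic; exact: measurable_itv.
have tr_le n x : `|tr n x| <= `|x|.
  by rewrite /tr normrM indicE; case: (_ \in _); rewrite ?normr1 ?mulr1// normr0 mulr0.
have btr n : exists K, forall x, `|tr n x| <= K.
  exists n%:R => x; rewrite /tr indicE; have [xn|_] := boolP (x \in _).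
    by move: xn; rewrite mulr1 inE/= in_itv/= -ler_norml.
  by rewrite mulr0 normr0.
have tr_cvg x : tr n x @[n --> \oo] --> x.
  apply: cvg_near_cst; near=> n; rewrite /tr indicE mem_set ?mulr1//= in_itv/= -ler_norml.
  by near: n; exact: nbhs_infty_ger.
have mtrX n k : measurable_fun setT (fun w => tr n (X k w)) by exact: measurableT_comp.
have C1 k : \int[P]_w tr n (X k w) @[n --> \oo] --> (0 : R).
  rewrite -(RV_integrable k).2.
  apply: (mean_dominated_cvg (g := fun w => `|X k w|)) => //.
  exact: integrable_norm (RV_integrable k).1.
have C2 : \int[P]_w (tr n (X i w) * tr n (X j w)) @[n --> \oo] --> \int[P]_w (X i w * X j w).
  apply: (mean_dominated_cvg (g := fun w => `|X i w * X j w|)) => //.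
  - by move=> n; exact: measurable_funM.
  - by move=> w; exact: cvgM.
  - exact: integrable_norm (RV_mul_integrable i j).
  - by move=> n w; have := ler_pM (normr_ge0 _) (normr_ge0 _) (tr_le n (X i w)) (tr_le n (X j w)); rewrite -!normrM.
have E n : \int[P]_w (tr n (X i w) * tr n (X j w)) =
    \int[P]_w tr n (X i w) * \int[P]_w tr n (X j w).
  have us : uniq [:: i; j] by rewrite /= inE ij.
  have := mean_prod mX indX us (fun=> mtr n) (fun=> btr n).
  rewrite !big_cons big_nil mulr1 => <-.
  by apply: eq_Rintegral => w _; rewrite !big_cons big_nil mulr1.
have C3 : \int[P]_w (tr n (X i w) * tr n (X j w)) @[n --> \oo] --> (0 * 0 : R).
  by under eq_fun do rewrite E; exact: cvgM.
by rewrite mulr0 in C3; exact: (cvg_unique _ C2 C3).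
Unshelve. all: by end_near. Qed.

Lemma lin_comb_uncorrelated a m j : (m <= j)%N ->
  P.-integrable setT (EFin \o (fun w => lin_comb (fun i => X i) a m w * X j w)) /\
  \int[P]_w (lin_comb (fun i => X i) a m w * X j w) = 0.
Proof.
elim: m => [_|m IH mj].
  have -> : (fun w => lin_comb (fun i => X i) a 0 w * X j w) = cst 0.
    by apply/funext => w; rewrite /lin_comb big_ord0 mul0r.
  by split; [exact: finite_measure_integrable_cst|exact: mean_cst].
have [i1 e1] := IH (ltnW mj).
have i2 := integrableZl measurableT (a m) (RV_mul_integrable m j).
have -> : (fun w => lin_comb (fun i => X i) a m.+1 w * X j w) =
    (fun w => lin_comb (fun i => X i) a m w * X j w + a m * (X m w * X j w)).
  by apply/funext => w; rewrite /lin_comb big_ord_recr/=; ring.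
split; first exact: (integrableD measurableT i1 i2).
rewrite (RintegralD measurableT i1 i2) e1 RintegralZl ?RV_uncorrelated ?mulr0 ?addr0//.
  by rewrite neq_ltn mj.
exact: RV_mul_integrable.
Qed.

Lemma lin_comb_sqr_moment a m :
  P.-integrable setT (EFin \o (fun w => lin_comb (fun i => X i) a m w ^+ 2)) /\
  \int[P]_w (lin_comb (fun i => X i) a m w ^+ 2) = sigma ^+ 2 * \sum_(i < m) a i ^+ 2.
Proof.
elim: m => [|m [i1 e1]].
  have -> : (fun w => lin_comb (fun i => X i) a 0 w ^+ 2) = cst 0.
    by apply/funext => w; rewrite /lin_comb big_ord0 expr0n.
  by rewrite big_ord0 mulr0; split; [exact: finite_measure_integrable_cst|exact: mean_cst].
have [i2 e2] := lin_comb_uncorrelated a (leqnn m).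
have [i3 e3] := RV_sqr_integrable m.
have j2 := integrableZl measurableT (2 * a m) i2.
have j3 := integrableZl measurableT (a m ^+ 2) i3.
have j12 := integrableD measurableT i1 j2.
have -> : (fun w => lin_comb (fun i => X i) a m.+1 w ^+ 2) =
    (fun w => (lin_comb (fun i => X i) a m w ^+ 2 +
      2 * a m * (lin_comb (fun i => X i) a m w * X m w)) + a m ^+ 2 * X m w ^+ 2).
  by apply/funext => w; rewrite /lin_comb big_ord_recr/=; ring.
split; first exact: (integrableD measurableT j12 j3).
rewrite (RintegralD measurableT j12 j3) (RintegralD measurableT i1 j2).
rewrite (RintegralZl _ measurableT i2) (RintegralZl _ measurableT i3).
by rewrite e1 e2 e3 big_ord_recr/=; ring.
Qed.

End CharacteristicFunctionCLT.

(** * Quadratic forms bounded below, and their inverses *)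

Lemma sum_le_const {R : realType} {n : nat} (F : 'I_n -> R) (c : R) :
  (forall j, F j <= c) -> \sum_j F j <= n%:R * c.
Proof.
move=> Fc; apply: (@le_trans _ _ (\sum_(j < n) c)); first by apply: ler_sum => j _.
by rewrite sumr_const card_ord mulr_natl.
Qed.

Section Coercivity.
Context {R : realType} {p : nat}.
Notation V := 'cV[R]_p.
Implicit Types (v t : V) (C D : 'M[R]_p) (kappa : R).

(** The norm is the maximum of the coordinates, which is where the powers of [p] in the estimates
    below come from. *)
Definition coercive kappa C := forall v, kappa * `|v| ^+ 2 <= dotp v (C *m v).

Lemma dotpC t v : dotp t v = dotp v t.
Proof. by rewrite !dotpE; apply: eq_bigr => j _; rewrite mulrC. Qed.

Lemma dotpZl (a : R) t v : dotp (a *: t) v = a * dotp t v.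
Proof. by rewrite /dotp linearZ/= -scalemxAl mxE. Qed.

Lemma dotpZr (a : R) t v : dotp t (a *: v) = a * dotp t v.
Proof. by rewrite dotpC dotpZl dotpC. Qed.

Lemma dotp_mulmx {m} (D : 'M[R]_(p, m)) t (v : 'cV[R]_m) :
  dotp t (D *m v) = dotp (D^T *m t) v.
Proof. by rewrite /dotp trmx_mul trmxK mulmxA. Qed.

Lemma dotp_norm t v : `|dotp t v| <= p%:R * `|t| * `|v|.
Proof.
apply: le_trans (dotp_le _ _) _; apply: ler_wpM2r => //.
by apply: sum_le_const => j; exact: coord_le_norm.
Qed.

Lemma mulmx_norm_le D v : `|D *m v| <= p%:R * `|D| * `|v|.
Proof.
apply: norm_le_coord => [|i]; first by rewrite !mulr_ge0.
rewrite mxE; apply: le_trans (ler_norm_sum _ _ _) _.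
rewrite -mulrA; apply: sum_le_const => j.
rewrite normrM ler_pM ?coord_le_norm//.
rewrite [leRHS]mx_normrE.
exact: (le_bigmax_cond _ (fun ij => `|D ij.1 ij.2|) (j := (i, j))).
Qed.

Lemma coercive_unit kappa C : 0 < kappa -> coercive kappa C -> C \in unitmx.
Proof.
move=> k0 cC; rewrite -unitmx_tr -row_free_unit -kermx_eq0; apply/rowV0P => r.
rewrite sub_kermx => /eqP rC.
have Cr : C *m r^T = 0 by rewrite -[C]trmxK -trmx_mul rC trmx0.
have := cC r^T; rewrite Cr /dotp mulmx0 mxE pmulr_rle0//.
move=> h; apply/eqP; rewrite -trmx_eq0 -normr_eq0 -sqrf_eq0 eq_le h sqr_ge0.
by [].
Qed.

(** The constant is explicit: [v_j^2 <= (C^-1)_jj * q], where [q] is the form at [v], so [1 / kappa]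
    can be the trace of [C^-1] plus 1. The 1 keeps it positive for [p = 0]. *)
Lemma posdef_coercive C : posdef C -> exists2 kappa, 0 < kappa & coercive kappa C.
Proof.
move=> [CT Cpos].
have quadE v : (v^T *m C *m v) 0 0 = dotp v (C *m v) by rewrite /dotp mulmxA.
have Cge v : 0 <= dotp v (C *m v).
  have [->|v0] := eqVneq v 0; first by rewrite dotp0l.
  by rewrite -quadE; exact/ltW/Cpos.
have uC : C \in unitmx.
  rewrite -unitmx_tr -row_free_unit -kermx_eq0; apply/rowV0P => r.
  rewrite sub_kermx => /eqP rC.
  have Cr : C *m r^T = 0 by rewrite -[C]trmxK -trmx_mul rC trmx0.
  apply/eqP/negPn/negP => r0.
  have := Cpos r^T; rewrite quadE Cr /dotp mulmx0 mxE ltxx => /(_ _)/wrap[]//.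
  by apply: contra r0 => /eqP r0; rewrite -[r]trmxK r0 trmx0.
pose u j : V := invmx C *m delta_mx j 0.
pose K := \sum_j dotp (u j) (C *m u j) + 1.
have K0 : 0 < K by rewrite ltr_pwDr// sumr_ge0.
exists K^-1; first by rewrite invr_gt0.
move=> v; rewrite mulrC ler_pdivrMr// mulrC.
set q := dotp v (C *m v).
suff coord j : `|v j 0| <= Num.sqrt (K * q).
  have : `|v| <= Num.sqrt (K * q) by apply: norm_le_coord => //; exact: sqrtr_ge0.
  move=> /(fun h => ler_pM (normr_ge0 v) (normr_ge0 v) h h).
  rewrite -!expr2 sqr_sqrtr; first exact.
  by apply: mulr_ge0; [exact: ltW|exact: Cge].
(* Cauchy-Schwarz for the form [C] applied to [v] and [C^-1 e_j] *)
pose b := dotp (u j) (C *m u j).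
have Cu : C *m u j = delta_mx j 0 by rewrite /u mulKVmx.
have dv : dotp v (C *m u j) = v j 0.
  rewrite Cu dotpE (bigD1 j)//= big1 ?addr0 => [|i ij]; first by rewrite mxE !eqxx mulr1.
  by rewrite mxE (negbTE ij) mulr0.
have du : dotp (u j) (C *m v) = v j 0.
  by rewrite dotp_mulmx CT dotpC.
have quad s : 0 <= q - 2 * s * v j 0 + s ^+ 2 * b.
  have -> : q - 2 * s * v j 0 + s ^+ 2 * b = dotp (v - s *: u j) (C *m (v - s *: u j)).
    rewrite mulmxBr -scalemxAr dotpBl !dotpBr /q.
    by rewrite !dotpZl !dotpZr dv du -/b; ring.
  exact: Cge.
rewrite -sqrtr_sqr ler_wsqrtr//.
have bK : b <= K.
  by rewrite /K (bigD1 j)//= -addrA lerDl addr_ge0// sumr_ge0.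
have q0 : 0 <= q by exact: Cge.
apply: (@le_trans _ _ (b * q)); last by rewrite ler_wpM2r.
have b0 : 0 <= b by exact: Cge.
(* For [b = 0] the quadratic in [s] is affine, and this [s] would give it the value -1 unless
   [v j 0 = 0]. Otherwise the minimiser [s = v j 0 / b] gives Cauchy-Schwarz. *)
have [b1|b1] := eqVneq b 0.
  have := quad ((q + 1) / (2 * v j 0)); rewrite b1 mulr0 addr0 mul0r.
  have [->|vj] := eqVneq (v j 0) 0; first by rewrite expr0n.
  have -> : 2 * ((q + 1) / (2 * v j 0)) * v j 0 = q + 1 by field.
  by rewrite opprD addrA subrr add0r oppr_ge0 ler10.
have := quad (v j 0 / b).
have -> : q - 2 * (v j 0 / b) * v j 0 + (v j 0 / b) ^+ 2 * b = q - v j 0 ^+ 2 / b by field.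
by rewrite subr_ge0 ler_pdivrMr ?lt_neqAle ?(eq_sym 0) ?b1// mulrC.
Qed.

Lemma coercive_perturb kappa C D : coercive kappa C ->
  p%:R ^+ 2 * `|D - C| <= kappa / 2 -> coercive (kappa / 2) D.
Proof.
move=> cC DC v.
have -> : D = C + (D - C) by rewrite addrC subrK.
rewrite mulmxDl dotpC dotpDl dotpC (dotpC (_ *m v)).
have h : `|dotp v ((D - C) *m v)| <= kappa / 2 * `|v| ^+ 2.
  apply: le_trans (dotp_norm _ _) _.
  apply: (@le_trans _ _ (p%:R * `|v| * (p%:R * `|D - C| * `|v|))).
    by rewrite ler_wpM2l ?mulr_ge0// mulmx_norm_le.
  have -> : p%:R * `|v| * (p%:R * `|D - C| * `|v|) = (p%:R ^+ 2 * `|D - C|) * `|v| ^+ 2 by ring.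
  by rewrite ler_wpM2r ?sqr_ge0.
have := cC v; move: h; rewrite ler_norml => /andP[h _].
by move: h; set x := `|v| ^+ 2; lra.
Qed.

(** For [u = C^-1 t], coercivity gives [kappa |u|^2 <= dotp u t <= p |u| |t|]. Only [kappa] enters,
    so the bound is uniform over all late Gram matrices. *)
Lemma coercive_invmx kappa C t : 0 < kappa -> coercive kappa C ->
  `|invmx C *m t| <= p%:R / kappa * `|t|.
Proof.
move=> k0 cC; have uC := coercive_unit k0 cC.
set u := invmx C *m t.
have Cu : C *m u = t by rewrite mulKVmx.
have := cC u; rewrite Cu => h.
have [->|u0] := eqVneq `|u| 0; first by rewrite !mulr_ge0// invr_ge0 ltW.
have up : 0 < `|u| by rewrite lt_neqAle eq_sym u0/=.
have : kappa * `|u| ^+ 2 <= p%:R * `|u| * `|t|.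
  by apply: le_trans h _; apply: le_trans (ler_norm _) (dotp_norm _ _).
have -> : kappa * `|u| ^+ 2 = (kappa * `|u|) * `|u| by ring.
have -> : p%:R * `|u| * `|t| = (p%:R * `|t|) * `|u| by ring.
rewrite ler_pM2r// => h2.
by rewrite mulrAC ler_pdivlMr// mulrC.
Qed.

End Coercivity.

(** * Penalized least squares *)

Section PenalizedLeastSquares.
Context {R : realType} {n p : nat}.
Implicit Types (X : 'M[R]_(n, p)) (y : 'cV[R]_n) (b v : 'cV[R]_p).

Lemma least_squares_pythagoras X y b b0 : X^T *m X *m b0 = X^T *m y ->
  \sum_(i < n) ((y - X *m b) i 0) ^+ 2 =
  \sum_(i < n) ((y - X *m b0) i 0) ^+ 2 + \sum_(i < n) ((X *m (b - b0)) i 0) ^+ 2.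
Proof.
move=> normal.
have orth : \sum_(i < n) (y - X *m b0) i 0 * (X *m (b - b0)) i 0 = 0.
  have <- : dotp (X *m (b - b0)) (y - X *m b0) = \sum_(i < n) (y - X *m b0) i 0 * (X *m (b - b0)) i 0.
    by rewrite dotpE; apply: eq_bigr => i _; rewrite mulrC.
  by rewrite /dotp trmx_mul -mulmxA mulmxBr mulmxA normal subrr mulmx0 mxE.
rewrite -big_split/=; set A := RHS.
(* Inserting the vanishing cross term makes the identity true summand by summand. *)
have -> : A = A - 2 * \sum_(i < n) (y - X *m b0) i 0 * (X *m (b - b0)) i 0.
  by rewrite orth mulr0 subr0.
rewrite /A mulr_sumr -sumrB.
apply: eq_bigr => i _.
have -> : (y - X *m b) i 0 = (y - X *m b0) i 0 - (X *m (b - b0)) i 0.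
  by rewrite mulmxBr !mxE; ring.
by ring.
Qed.

(** With [r] the second root and [dd = alpha |s - t|], [(r + dd)^2 >= r^2 + 2 dd] because [r >= 1]:
    the 1 under the root keeps the slope bounded at the origin. *)
Lemma sqrt_penalty_lipschitz (alpha s t : R) : 0 < alpha ->
  Num.sqrt (1 + 2 * alpha * `|s|) - Num.sqrt (1 + 2 * alpha * `|t|) <= alpha * `|s - t|.
Proof.
move=> a0; rewrite lerBlDr.
have st : `|s| <= `|t| + `|s - t|.
  by rewrite -[X in `|X| <= _](subrK t s) addrC; exact: ler_normD.
have a1 : 0 <= alpha * `|s - t| by rewrite mulr_ge0// ltW.
have t1 : 1 <= Num.sqrt (1 + 2 * alpha * `|t|).
  by rewrite -[leLHS]sqrtr1 ler_wsqrtr// lerDl !mulr_ge0// ltW.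
have r2 : Num.sqrt (1 + 2 * alpha * `|t|) ^+ 2 = 1 + 2 * alpha * `|t|.
  by rewrite sqr_sqrtr// addr_ge0// !mulr_ge0// ltW.
have as_ : alpha * `|s| <= alpha * `|t| + alpha * `|s - t|.
  by rewrite -mulrDr ler_wpM2l// ltW.
move: t1 r2 a1 as_; set r := Num.sqrt _; set dd := alpha * `|s - t| => t1 r2 a1 as_.
have z0 : 0 <= dd + r by lra.
apply: (@le_trans _ _ (Num.sqrt ((dd + r) ^+ 2))); last by rewrite sqrtr_sqr ger0_norm.
rewrite ler_wsqrtr// sqrrD r2.
have : dd * 1 <= dd * r by rewrite ler_wpM2l.
by have := sqr_ge0 dd; rewrite -mulr_natl; lra.
Qed.

(** Comparing objectives gives [kappa |v|^2 <= |X v|^2 <= p eta |v|] for [v = b - b0]. The Lipschitz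
    constant [alpha] cancels the denominator in [eta / alpha], so the bound is uniform in
    [alpha]. *)
Lemma penalized_close X y (eta alpha kappa : R) b b0 :
  0 < eta -> 0 < alpha -> 0 < kappa ->
  (forall v, kappa * `|v| ^+ 2 <= \sum_(i < n) ((X *m v) i 0) ^+ 2) ->
  X^T *m X *m b0 = X^T *m y ->
  penalized_obj X y eta alpha b <= penalized_obj X y eta alpha b0 ->
  `|b - b0| <= p%:R * eta / kappa.
Proof.
move=> eta0 alpha0 kappa0 coer normal; rewrite /penalized_obj (least_squares_pythagoras b normal).
rewrite -!addrA lerD2l -lerBrDr -mulrBr -sumrB => h.
set v := b - b0 in h *.
have h2 : kappa * `|v| ^+ 2 <= p%:R * eta * `|v|.
  apply: le_trans (coer v) _; apply: le_trans h _.
  rewrite mulrAC ler_pdivrMr//.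
  have -> : p%:R * eta * `|v| * alpha = eta * (p%:R * (`|v| * alpha)) by ring.
  rewrite ler_wpM2l ?(ltW eta0)//.
  apply: sum_le_const => j; rewrite opprB addrA subrK.
  apply: le_trans (sqrt_penalty_lipschitz _ _ alpha0) _.
  rewrite mulrC ler_wpM2r ?(ltW alpha0)// distrC.
  by have := coord_le_norm v j; rewrite !mxE.
have [->|v0] := eqVneq `|v| 0; first by rewrite !mulr_ge0// ?invr_ge0 ltW.
have vp : 0 < `|v| by rewrite lt_neqAle eq_sym v0/=.
move: h2; have -> : kappa * `|v| ^+ 2 = (kappa * `|v|) * `|v| by ring.
by rewrite ler_pM2r// => h2; rewrite ler_pdivlMr// mulrC.
Qed.

End PenalizedLeastSquares.

(** With [A_i] the averages, [a i = i (A_(i+1) - A_i) + A_(i+1)], which is [o(i)] since the averages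
    converge. The finitely many early terms are absorbed by taking [n] large. *)
Lemma average_terms_small {R : realType} (a : nat -> R) (l : R) : (forall i, 0 <= a i) ->
  n%:R^-1 * \sum_(i < n) a i @[n --> \oo] --> l ->
  forall delta, 0 < delta -> \forall n \near \oo, forall i, (i < n)%N -> a i <= delta * n%:R.
Proof.
move=> a0 al delta delta0.
have d40 : 0 < delta / 4 by rewrite divr_gt0.
have /cvgrPdist_le/(_ _ d40)[N1 _ N1P] := al.
(* Beyond [N1] the first summand is at most [i * (delta / 2)]; beyond [N2] the second, at most
   [|l| + delta], fits into [i * (delta / 4)]. *)
have [N2 N2P] : exists N2 : nat, (`|l| + delta) <= delta / 4 * N2%:R.
  exists (Num.bound ((`|l| + delta) / (delta / 4))).
  rewrite mulrC -ler_pdivrMr//; apply/ltW/archi_boundP.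
  by rewrite divr_ge0 ?(ltW d40)// addr_ge0// ltW.
pose N := maxn N1 N2.
have tail i : (N <= i)%N -> a i <= delta * i%:R.
  move=> Ni.
  have i1 : (N1 <= i)%N by rewrite (leq_trans _ Ni)// leq_maxl.
  have i2 : (N2 <= i)%N by rewrite (leq_trans _ Ni)// leq_maxr.
  have := N1P i i1; have := N1P i.+1 (leqW i1) => /=.
  rewrite big_ord_recr/=; set S := \sum_(i0 < i) _ => h1 h2.
  have hi : `|l| + delta <= delta / 4 * i%:R.
    by apply: le_trans N2P _; rewrite ler_wpM2l ?(ltW d40)// ler_nat.
  have ip : 0 < i%:R :> R.
    by rewrite lt_neqAle ler0n andbT eq_sym; apply/eqP => i0; move: hi; rewrite i0; have := normr_ge0 l; lra.
  have SE : S = i%:R * (i%:R^-1 * S) by rewrite mulVKf// gt_eqF.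
  have aE : a i = i.+1%:R * (i.+1%:R^-1 * (S + a i)) - i%:R * (i%:R^-1 * S).
    by rewrite -SE mulVKf ?pnatr_eq0//; ring.
  move: h1 h2 aE; set A1 := i.+1%:R^-1 * _; set A0 := i%:R^-1 * S.
  rewrite !ler_norml => /andP[h1 h1'] /andP[h2 h2'] ->; rewrite -[X in X * A1]natr1.
  have ll := ler_norm l; have l0 := normr_ge0 l.
  have k1 : i%:R * (A1 - A0) <= i%:R * (delta / 2) by rewrite ler_wpM2l ?ler0n//; lra.
  by lra.
near=> n => i ni.
have [Ni|iN] := leqP N i.
  by apply: le_trans (tail i Ni) _; rewrite ler_wpM2l ?(ltW delta0)// ler_nat ltnW.
apply: (@le_trans _ _ (\sum_(k < N) a k)).
  by rewrite (bigD1 (Ordinal iN))//= lerDl sumr_ge0.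
rewrite mulrC -ler_pdivrMr//.
by near: n; exact: nbhs_infty_ger.
Unshelve. all: by end_near. Qed.

(** * Gram matrices and the weights of the noise variables *)

Section LeastSquaresDeviation.
Context {R : realType} {p : nat} (xs : nat -> 'rV[R]_p).
Implicit Types (t v : 'cV[R]_p) (kappa : R).

Definition gram n : 'M[R]_p := n%:R^-1 *: ((design xs n)^T *m design xs n).

(** The coefficient of [eps i] in the scaled least squares error paired with [t]; see
    [dotp_ols_dev]. *)
Definition weight n t (i : nat) : R :=
  (Num.sqrt n%:R)^-1 * (xs i *m (invmx (gram n) *m t)) 0 0.

Lemma gramT n : (gram n)^T = gram n.
Proof. by rewrite /gram linearZ/= trmx_mul trmxK. Qed.

Lemma design_mulE n v (i : 'I_n) : (design xs n *m v) i 0 = (xs i *m v) 0 0.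
Proof. by rewrite !mxE; apply: eq_bigr => k _; rewrite mxE. Qed.

Lemma gram_quad n v : (0 < n)%N ->
  \sum_(i < n) ((design xs n *m v) i 0) ^+ 2 = n%:R * dotp v (gram n *m v).
Proof.
move=> n0; rewrite /gram -scalemxAl dotpZr mulVKf ?pnatr_eq0 -?lt0n//.
rewrite -mulmxA dotp_mulmx trmxK dotpE.
by apply: eq_bigr => i _; rewrite expr2.
Qed.

Lemma sqrt_natV n : (Num.sqrt n%:R : R)^-1 * (Num.sqrt n%:R)^-1 = n%:R^-1.
Proof. by rewrite -invfM -expr2 sqr_sqrtr. Qed.

Lemma weight_sqr_sum n t : (0 < n)%N -> gram n \in unitmx ->
  \sum_(i < n) weight n t i ^+ 2 = dotp (invmx (gram n) *m t) t.
Proof.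
move=> n0 ug; set s := invmx (gram n) *m t.
have gs : gram n *m s = t by rewrite mulKVmx.
have := gram_quad s n0; rewrite gs => h.
have -> : dotp s t = n%:R^-1 * (n%:R * dotp s t) by rewrite mulKf ?pnatr_eq0 -?lt0n.
rewrite -h mulr_sumr; apply: eq_bigr => i _.
by rewrite /weight exprMn design_mulE -/s !expr2 sqrt_natV.
Qed.

(** By [weight_sqr_sum] this is convergence of the inverse Gram form at [t]. The resolvent identity
    [C^-1 - G^-1 = G^-1 (G - C) C^-1], with [G^-1] bounded by coercivity, gives it. *)
Lemma weight_cvg (C : 'M[R]_p) kappa t : 0 < kappa -> C \in unitmx -> gram n @[n --> \oo] --> C ->
  (\forall n \near \oo, coercive kappa (gram n)) ->
  \sum_(i < n) weight n t i ^+ 2 @[n --> \oo] --> dotp (invmx C *m t) t.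
Proof.
move=> k0 uC gC cg.
set s := invmx C *m t.
have Cs : C *m s = t by rewrite mulKVmx.
apply/cvgrPdist_le => e e0.
pose K := p%:R * (p%:R / kappa * (p%:R * `|s|)) * `|t| + 1.
have K0 : 0 < K by rewrite ltr_pwDr// !mulr_ge0// invr_ge0 ltW.
have eK0 : 0 < e / K by rewrite divr_gt0.
have /cvgrPdist_le/(_ _ eK0) gCe := gC.
near=> n.
have n0 : (0 < n)%N by near: n; exact: nbhs_infty_gt.
have cn : coercive kappa (gram n) by near: n.
have un := coercive_unit k0 cn.
rewrite weight_sqr_sum//.
have -> : dotp s t - dotp (invmx (gram n) *m t) t = dotp (invmx (gram n) *m ((gram n - C) *m s)) t.
  rewrite -dotpBl; congr dotp; rewrite mulmxBl Cs mulmxBr mulKmx//.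
apply: le_trans (dotp_norm _ _) _.
have h1 : `|invmx (gram n) *m ((gram n - C) *m s)| <= p%:R / kappa * (p%:R * `|gram n - C| * `|s|).
  apply: le_trans (coercive_invmx _ k0 cn) _.
  by rewrite ler_wpM2l ?mulmx_norm_le// divr_ge0// ltW.
have h2 : `|gram n - C| <= e / K by rewrite distrC; near: n.
apply: (@le_trans _ _ (p%:R * (p%:R / kappa * (p%:R * (e / K) * `|s|)) * `|t|)).
  rewrite ler_wpM2r// ler_wpM2l//; apply: le_trans h1 _.
  rewrite ler_wpM2l ?divr_ge0 ?(ltW k0)// ler_wpM2r// ler_wpM2l//.
have -> : p%:R * (p%:R / kappa * (p%:R * (e / K) * `|s|)) * `|t| = e * ((K - 1) / K).
  have -> : K - 1 = p%:R * (p%:R / kappa * (p%:R * `|s|)) * `|t| by rewrite /K addrK.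
  by move: (K^-1) (kappa^-1) => K1 k1; ring.
rewrite ler_piMr ?(ltW e0)// ler_pdivrMr// mul1r; lra.
Unshelve. all: by end_near. Qed.

(** The diagonal Gram entries are averages of squared coordinates, so [average_terms_small] gives
    [|x_i| = o(sqrt n)] uniformly in [i < n]; the inverse Gram factor stays bounded by [B]. *)
Lemma weight_max_small (C : 'M[R]_p) kappa t : 0 < kappa -> gram n @[n --> \oo] --> C ->
  (\forall n \near \oo, coercive kappa (gram n)) ->
  forall delta : R, 0 < delta ->
  \forall n \near \oo, forall i, (i < n)%N -> `|weight n t i| <= delta.
Proof.
move=> k0 gC cg delta delta0.
pose B := p%:R / kappa * `|t|.
have B0 : 0 <= B by rewrite mulr_ge0 ?divr_ge0 ?(ltW k0).
pose d1 := delta / (p%:R * B + 1).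
have pB : 0 < p%:R * B + 1 by rewrite ltr_pwDr// mulr_ge0.
have d10 : 0 < d1 by rewrite divr_gt0.
have d120 : 0 < d1 ^+ 2 by rewrite exprn_gt0.
have small (k : 'I_p) : \forall n \near \oo, forall i, (i < n)%N -> xs i 0 k ^+ 2 <= d1 ^+ 2 * n%:R.
  apply: (average_terms_small (l := C k k)) => //.
    by move=> i; exact: sqr_ge0.
  have gkk : gram n k k @[n --> \oo] --> C k k.
    apply/cvgrPdist_le => e e0; have /cvgrPdist_le/(_ _ e0) := gC.
    apply: filterS => n; apply: le_trans.
    have -> : C k k - gram n k k = (C - gram n) k k by rewrite !mxE.
    rewrite [leRHS]mx_normrE.
    exact: (le_bigmax_cond _ (fun ij => `|(C - gram n) ij.1 ij.2|) (j := (k, k))).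
  have -> : (fun n => n%:R^-1 * \sum_(i < n) xs i 0 k ^+ 2) = (fun n => gram n k k).
    apply/funext => n; rewrite !mxE; congr (_ * _).
    by apply: eq_bigr => i _; rewrite !mxE expr2.
  exact: gkk.
near=> n => i ni.
have n0 : (0 < n)%N by exact: leq_ltn_trans ni.
have cn : coercive kappa (gram n) by near: n.
have sn0 : 0 < Num.sqrt n%:R :> R by rewrite sqrtr_gt0 ltr0n.
have xk (k : 'I_p) : `|xs i 0 k| <= d1 * Num.sqrt n%:R.
  have : forall k : 'I_p, forall i, (i < n)%N -> xs i 0 k ^+ 2 <= d1 ^+ 2 * n%:R.
    by near: n; exact: filter_forall.
  move=> /(_ k i ni); rewrite -{1}(@sqr_sqrtr R n%:R)// -exprMn.
  rewrite -(real_normK (num_real (xs i 0 k))) ler_pXn2r ?nnegrE// mulr_ge0// ltW//.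
rewrite /weight normrM gtr0_norm ?invr_gt0// mulrC ler_pdivrMr//.
rewrite mxE; apply: le_trans (ler_norm_sum _ _ _) _.
apply: (@le_trans _ _ (p%:R * (d1 * Num.sqrt n%:R * B))).
  apply: sum_le_const => k; rewrite normrM ler_pM//.
  by apply: le_trans (coord_le_norm _ _) _; exact: coercive_invmx.
have -> : p%:R * (d1 * Num.sqrt n%:R * B) = (d1 * (p%:R * B)) * Num.sqrt n%:R by ring.
rewrite ler_pM2r// /d1 mulrAC ler_pdivrMr// ler_wpM2l ?(ltW delta0)//; lra.
Unshelve. all: by end_near. Qed.

End LeastSquaresDeviation.

(** * The scaled least squares error: moments, tails, distance to the penalized one *)

Section Asymptotics.
Context {R : realType} {p : nat} {d : measure_display} {T : measurableType d}
  (P : probability T R).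

Lemma mean_sum (I : Type) (r : seq I) (h : I -> T -> R) :
  (forall i, P.-integrable setT (EFin \o h i)) ->
  P.-integrable setT (EFin \o (fun w => \sum_(i <- r) h i w)) /\
  \int[P]_w (\sum_(i <- r) h i w) = \sum_(i <- r) \int[P]_w h i w.
Proof.
move=> ih; elim: r => [|i r [IH1 IH2]].
  have -> : (fun w => \sum_(i <- [::]) h i w) = cst 0 by apply/funext => w; rewrite big_nil.
  by rewrite big_nil; split; [exact: finite_measure_integrable_cst|exact: mean_cst].
have -> : (fun w => \sum_(j <- i :: r) h j w) = (fun w => h i w + \sum_(j <- r) h j w).
  by apply/funext => w; rewrite big_cons.
split; first exact: (integrableD measurableT (ih i) IH1).
by rewrite (RintegralD measurableT (ih i) IH1) big_cons IH2.
Qed.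

Lemma markov_norm (Z : T -> 'cV[R]_p) (v L : R) : coord_measurable Z -> 0 < L ->
  (forall j, P.-integrable setT (EFin \o (fun w => Z w j 0 ^+ 2)) /\
     \int[P]_w (Z w j 0 ^+ 2) <= v) ->
  (P [set w | (L < `|Z w|)%R] <= (p%:R * v / L ^+ 2)%:E)%E.
Proof.
move=> mZ L0 Zv.
have mB := measurable_norm_gt L mZ; set B := [set w | _] in mB *.
have [iS ES] := mean_sum (index_enum 'I_p) (fun j => (Zv j).1).
have iB := integrableZl measurableT (L ^+ 2) (integrable_indic P mB).
have -> : P B = (fine (P B))%:E by rewrite fineK// fin_num_measure.
rewrite lee_fin ler_pdivlMr ?exprn_gt0//.
have -> : fine (P B) * L ^+ 2 = \int[P]_w (L ^+ 2 * \1_B w).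
  rewrite RintegralZl//; last exact: integrable_indic.
  by rewrite mulrC /Rintegral integral_indic// setIT.
apply: (@le_trans _ _ (\sum_j \int[P]_w (Z w j 0 ^+ 2))); last first.
  by apply: sum_le_const => j; exact: (Zv j).2.
rewrite -ES; apply: (le_Rintegral measurableT iB iS) => w _.
rewrite indicE; have [wB|_] := boolP (w \in B); last first.
  by rewrite mulr0 sumr_ge0// => j _; exact: sqr_ge0.
rewrite mulr1; move: wB; rewrite inE /B/= => Lw.
have Q0 : 0 <= \sum_j Z w j 0 ^+ 2 by rewrite sumr_ge0// => j _; exact: sqr_ge0.
rewrite leNgt; apply/negP => SL.
have : `|Z w| <= Num.sqrt (\sum_j Z w j 0 ^+ 2).
  apply: norm_le_coord => [|j]; first exact: sqrtr_ge0.
  rewrite -sqrtr_sqr ler_wsqrtr// (bigD1 j)//= lerDl sumr_ge0// => k _; exact: sqr_ge0.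
apply/negP; rewrite -ltNge; apply: le_lt_trans Lw.
by rewrite -[leRHS]gtr0_norm// -sqrtr_sqr ler_wsqrtr// ltW.
Qed.

Context (xs : nat -> 'rV[R]_p) (eps : nat -> {RV P >-> R}).

Definition noise n w : 'cV[R]_n := \col_(i < n) eps i w.

(* [sqrt n] times the error of the ordinary least squares estimator *)
Definition ols_dev n w : 'cV[R]_p := (Num.sqrt n%:R)^-1 *:
  (invmx (gram xs n) *m ((design xs n)^T *m noise n w)).

Lemma dotp_ols_dev n t w :
  dotp t (ols_dev n w) = lin_comb (fun i => eps i) (weight xs n t) n w.
Proof.
rewrite /ols_dev dotpZr dotp_mulmx trmx_inv gramT dotp_mulmx trmxK dotpE mulr_sumr.
by apply: eq_bigr => i _; rewrite mulrA design_mulE [noise _ _ _ _]mxE.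
Qed.

Lemma ols_dev_coord n w j : ols_dev n w j 0 =
  lin_comb (fun i => eps i) (weight xs n (delta_mx j 0)) n w.
Proof.
rewrite -dotp_ols_dev dotpE (bigD1 j)//= big1 ?addr0 => [|i ij].
  by rewrite [delta_mx _ _ _ _]mxE !eqxx mul1r.
by rewrite [delta_mx _ _ _ _]mxE (negbTE ij) mul0r.
Qed.

Lemma measurable_ols_dev n : coord_measurable (ols_dev n).
Proof.
move=> j; under eq_fun do rewrite ols_dev_coord.
by apply: measurable_lin_comb => i; exact: measurable_funP.
Qed.

(** The normal equations identify [bstar + ols_dev n w / sqrt n] as the least squares estimator,
    which is the form [penalized_close] needs. *)
Lemma ols_dev_normal bstar n w : (0 < n)%N -> gram xs n \in unitmx ->
  (design xs n)^T *m design xs n *m (bstar + (Num.sqrt n%:R)^-1 *: ols_dev n w) =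
  (design xs n)^T *m response xs bstar (fun i => eps i) n w.
Proof.
move=> n0 ug.
have -> : response xs bstar (fun i => eps i) n w = design xs n *m bstar + noise n w.
  by apply/matrixP => i j; rewrite (ord1 j) [RHS]mxE design_mulE !mxE.
rewrite !mulmxDr mulmxA; congr (_ + _).
rewrite /ols_dev scalerA sqrt_natV -scalemxAr scalemxAl -/(gram xs n).
by rewrite mulKVmx.
Qed.

Lemma penalized_near_ols bstar n w (eta alpha kappa : R) b :
  (0 < n)%N -> 0 < eta -> 0 < alpha -> 0 < kappa -> coercive kappa (gram xs n) ->
  (forall b', penalized_obj (design xs n) (response xs bstar (fun i => eps i) n w) eta alpha b <=
    penalized_obj (design xs n) (response xs bstar (fun i => eps i) n w) eta alpha b') ->
  `|Num.sqrt n%:R *: (b - bstar) - ols_dev n w| <= p%:R / kappa * (eta / Num.sqrt n%:R).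
Proof.
move=> n0 eta0 alpha0 kappa0 cg bmin.
have np : 0 < n%:R :> R by rewrite ltr0n.
have sn0 : 0 < Num.sqrt n%:R :> R by rewrite sqrtr_gt0.
have ug := coercive_unit kappa0 cg.
have coer (v : 'cV[R]_p) : kappa * n%:R * `|v| ^+ 2 <= \sum_(i < n) ((design xs n *m v) i 0) ^+ 2.
  by rewrite gram_quad// mulrAC [leLHS]mulrC ler_wpM2l.
have := penalized_close eta0 alpha0 (mulr_gt0 kappa0 np) coer
  (ols_dev_normal bstar w n0 ug) (bmin _).
move=> /(ler_wpM2l (ltW sn0)); rewrite -{1}(gtr0_norm sn0) -normrZ.
have -> : Num.sqrt n%:R *: (b - (bstar + (Num.sqrt n%:R)^-1 *: ols_dev n w)) =
    Num.sqrt n%:R *: (b - bstar) - ols_dev n w.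
  by rewrite opprD addrA scalerBr scalerA divff ?gt_eqF// scale1r.
move=> /le_trans; apply.
suff -> : Num.sqrt n%:R * (p%:R * eta / (kappa * n%:R)) = p%:R / kappa * (eta / Num.sqrt n%:R) by [].
have : Num.sqrt n%:R ^+ 2 = n%:R :> R by rewrite sqr_sqrtr.
move: sn0; move: (Num.sqrt _) => s s0 <-.
by field; rewrite !gt_eqF.
Qed.

Section IIDNoise.
Context (sigma : R) (C : 'M[R]_p) (kappa : R).
Context (indep : mutually_independent P (fun i => eps i)).
Context (ident : identically_distributed P (fun i => eps i)).
Context (int0 : P.-integrable setT (EFin \o eps 0%N)).
Context (mean0 : 'E_P[eps 0%N]%E = 0%E).
Context (var0 : 'V_P[eps 0%N]%E = (sigma ^+ 2)%:E).
Context (gramC : gram xs n @[n --> \oo] --> C).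
Context (kappa0 : 0 < kappa).
Context (coer : \forall n \near \oo, coercive kappa (gram xs n)).

(** Coordinate [j] has second moment [sigma^2] times the [j]-th diagonal entry of the inverse Gram
    matrix. That entry is at most [p * (p / kappa)], by [dotp_norm] and [coercive_invmx]. *)
Lemma ols_dev_tail n L : (0 < n)%N -> coercive kappa (gram xs n) -> 0 < L ->
  (P [set w | (L < `|ols_dev n w|)%R] <=
    (p%:R * (sigma ^+ 2 * (p%:R * (p%:R / kappa))) / L ^+ 2)%:E)%E.
Proof.
move=> n0 cn L0; apply: markov_norm => //; first exact: measurable_ols_dev.
move=> j; have [i2 e2] := lin_comb_sqr_moment indep ident int0 mean0 var0 (weight xs n (delta_mx j 0)) n.
have -> : (fun w => ols_dev n w j 0 ^+ 2) =
    (fun w => lin_comb (fun i => eps i) (weight xs n (delta_mx j 0)) n w ^+ 2).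
  by apply/funext => w; rewrite ols_dev_coord.
split=> //; rewrite e2 ler_wpM2l ?sqr_ge0//.
rewrite weight_sqr_sum//; last exact: coercive_unit cn.
have d1 : `|delta_mx j 0 : 'cV[R]_p| <= 1.
  by apply: norm_le_coord => // i; rewrite mxE normr_nat; case: (_ && _); rewrite ?ler01.
apply: le_trans (ler_norm _) _; apply: le_trans (dotp_norm _ _) _.
rewrite -[leRHS]mulr1 ler_pM ?mulr_ge0// ler_wpM2l//.
apply: le_trans (coercive_invmx _ kappa0 cn) _.
by rewrite ler_piMr// divr_ge0// ltW.
Qed.

Lemma ols_dev_cf (t : 'cV[R]_p) (th : R) : C \in unitmx ->
  \int[P]_w cos (dotp t (ols_dev n w) + th) @[n --> \oo] -->
    expR (- (sigma ^+ 2 * dotp (invmx C *m t) t) / 2) * cos th.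
Proof.
move=> uC.
have -> : (fun n => \int[P]_w cos (dotp t (ols_dev n w) + th)) =
    (fun n => \int[P]_w cos (lin_comb (fun i => eps i) (weight xs n t) n w + th)).
  by apply/funext => n; apply: eq_Rintegral => w _; rewrite dotp_ols_dev.
apply: (clt_cf indep ident int0 mean0 var0).
  exact: weight_cvg kappa0 uC gramC coer.
exact: weight_max_small kappa0 gramC coer.
Qed.

End IIDNoise.

End Asymptotics.

Theorem theorem5 (R : realType) (p : nat) (d : measure_display)
  (T : measurableType d) (P : probability T R)
  (xs : nat -> 'rV[R]_p) (bstar : 'cV[R]_p)
  (eps : nat -> {RV P >-> R}) (sigma : R)
  (C : 'M[R]_p) (eta alpha : nat -> R)
  (btilde : nat -> T -> 'cV[R]_p) :
  mutually_independent P (fun i => eps i) ->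
  identically_distributed P (fun i => eps i) ->
  P.-integrable setT (EFin \o eps 0%N) ->
  'E_P[eps 0%N]%E = 0%E ->
  'V_P[eps 0%N]%E = (sigma ^+ 2)%:E ->
  (fun n : nat => n%:R^-1 *: ((design xs n)^T *m design xs n)) @ \oo --> C ->
  posdef C ->
  (forall n, 0 < eta n) -> (forall n, 0 < alpha n) ->
  alpha @ \oo --> 0 ->
  (forall n (i : 'I_p), measurable_fun setT (fun w => btilde n w i 0)) ->
  (forall n w (b : 'cV[R]_p),
     penalized_obj (design xs n) (response xs bstar (fun i => eps i) n w)
       (eta n) (alpha n) (btilde n w)
     <= penalized_obj (design xs n) (response xs bstar (fun i => eps i) n w)
       (eta n) (alpha n) b) ->
  (forall c3 : R, 0 <= c3 ->
     (fun n : nat => eta n / Num.sqrt n%:R) @ \oo --> 2 * c3 ->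
     cvg_prob P btilde bstar) /\
  ((fun n : nat => eta n / Num.sqrt n%:R) @ \oo --> 0 ->
     cvg_dist_normal P
       (fun n w => Num.sqrt n%:R *: (btilde n w - bstar))
       (sigma ^+ 2 *: invmx C)).
Proof.
move=> indep ident int0 mean0 var0 gramC Cpos eta0 alpha0 _ mb bmin.
have [kC kC0 cC] := posdef_coercive Cpos.
have uC := coercive_unit kC0 cC.
pose kappa := kC / 2.
have kappa0 : 0 < kappa by rewrite divr_gt0.
have coer : \forall n \near \oo, coercive kappa (gram xs n).
  (* This closeness meets the requirement of [coercive_perturb], at the price of half the constant
     of [C]. *)
  have q0 : 0 < kC / 2 / (p%:R ^+ 2 + 1) by rewrite divr_gt0// ltr_pwDr// sqr_ge0.
  have /cvgrPdist_le/(_ _ q0) := gramC.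
  apply: filterS => n h; apply: (coercive_perturb cC).
  have pp : 0 < p%:R ^+ 2 + 1 :> R by rewrite ltr_pwDr// sqr_ge0.
  move: h; rewrite distrC ler_pdivlMr// -/(gram xs n).
  by have := normr_ge0 (gram xs n - C); lra.
pose K := p%:R / kappa.
have K0 : 0 <= K by rewrite divr_ge0// ltW.
pose Z n w := Num.sqrt n%:R *: (btilde n w - bstar).
have near_ols : \forall n \near \oo, forall w,
    `|Z n w - ols_dev xs eps n w| <= K * (eta n / Num.sqrt n%:R).
  near=> n => w.
  apply: (penalized_near_ols _ (eta0 n) (alpha0 n) kappa0); last exact: bmin.
    by near: n; exact: nbhs_infty_gt.
  by near: n.
pose V := p%:R * (sigma ^+ 2 * (p%:R * (p%:R / kappa))).
have V0 : 0 <= V by do 2![apply: mulr_ge0 => //; rewrite ?sqr_ge0//]; rewrite mulr_ge0//.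
have tail : \forall n \near \oo, forall L, 0 < L ->
    (P [set w | (L < `|ols_dev xs eps n w|)%R] <= (V / L ^+ 2)%:E)%E.
  near=> n => L L0; apply: (ols_dev_tail indep ident int0 mean0 var0 kappa0) => //.
    by near: n; exact: nbhs_infty_gt.
  by near: n.
have mdiff n : coord_measurable (fun w => btilde n w - bstar).
  by move=> j; under eq_fun do rewrite !mxE; exact: measurable_funB.
have mZ n : coord_measurable (Z n).
  move=> j; rewrite /Z; under eq_fun do rewrite mxE.
  by apply: measurable_funM => //; exact: mdiff.
split=> [c3 c30 etac|eta_0].
  move=> e e0.
  (* A bounded distance suffices here: once [B <= (e / 2) sqrt n], an error above [e] forces the
     least squares deviation above [(e / 2) sqrt n], where the tail bound decays like [1 / n]. *)
  have [B [B0 etaB]] : exists B, 0 <= B /\ \forall n \near \oo, K * (eta n / Num.sqrt n%:R) <= B.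
    exists (K * (2 * c3 + 1)); split; first by rewrite mulr_ge0// addr_ge0// mulr_ge0.
    have /cvgrPdist_le/(_ _ ltr01) := etac; apply: filterS => n.
    by rewrite ler_norml => /andP[h _]; rewrite ler_wpM2l//; lra.
  have bound : \forall n \near \oo, (P [set w | (e < `|btilde n w - bstar|)%R] <=
      (V / (e / 2 * Num.sqrt n%:R) ^+ 2)%:E)%E.
    near=> n.
    have n0 : (0 < n)%N by near: n; exact: nbhs_infty_gt.
    have sn0 : 0 < Num.sqrt n%:R :> R by rewrite sqrtr_gt0 ltr0n.
    have L0 : 0 < e / 2 * Num.sqrt n%:R by rewrite mulr_gt0// divr_gt0.
    have tn : forall L, 0 < L ->
      (P [set w | (L < `|ols_dev xs eps n w|)%R] <= (V / L ^+ 2)%:E)%E by near: n.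
    apply: le_trans (tn _ L0); apply: le_measure; rewrite ?inE.
    - exact: measurable_norm_gt.
    - by apply: measurable_norm_gt; exact: measurable_ols_dev.
    move=> w /= ew.
    have zw : `|Z n w - ols_dev xs eps n w| <= B.
      apply: (@le_trans _ _ (K * (eta n / Num.sqrt n%:R))); last by near: n.
      have : forall w, `|Z n w - ols_dev xs eps n w| <= K * (eta n / Num.sqrt n%:R) by near: n.
      exact.
    have Bn : B <= e / 2 * Num.sqrt n%:R.
      have e20 : 0 < e / 2 by rewrite divr_gt0.
      rewrite mulrC -ler_pdivrMr//.
      apply: (@le_trans _ _ (Num.sqrt ((B / (e / 2)) ^+ 2))).
        by rewrite sqrtr_sqr ler_norm.
      by rewrite ler_wsqrtr//; near: n; exact: nbhs_infty_ger.
    have Zw : e * Num.sqrt n%:R < `|Z n w|.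
      by rewrite /Z normrZ gtr0_norm// mulrC ltr_pM2l.
    have := ler_distD 0 (Z n w) (ols_dev xs eps n w).
    have := ler_normD (Z n w - ols_dev xs eps n w) (ols_dev xs eps n w).
    by rewrite subrK; lra.
  have -> : (fun n => P [set w | (e < `|btilde n w - bstar|)%R]) =
      EFin \o (fun n => fine (P [set w | (e < `|btilde n w - bstar|)%R])).
    by apply/funext => n /=; rewrite fineK// fin_num_measure//; exact: measurable_norm_gt.
  apply: cvg_EFin; first exact: nearW.
  apply/cvgrPdist_le => r r0; near=> n.
  have n0 : (0 < n)%N by near: n; exact: nbhs_infty_gt.
  have np : 0 < n%:R :> R by rewrite ltr0n.
  rewrite /= sub0r normrN ger0_norm ?fine_ge0//.
  have h : (P [set w | (e < `|btilde n w - bstar|)%R] <= (V / (e / 2 * Num.sqrt n%:R) ^+ 2)%:E)%E.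
    by near: n.
  rewrite -lee_fin fineK ?fin_num_measure//; last exact: measurable_norm_gt.
  apply: le_trans h _; rewrite lee_fin exprMn sqr_sqrtr//.
  have e2 : 0 < (e / 2) ^+ 2 by rewrite exprn_gt0// divr_gt0.
  rewrite ler_pdivrMr ?mulr_gt0// mulrA -ler_pdivrMl ?mulr_gt0//.
  by near: n; exact: nbhs_infty_ger.
move=> A AE f cf bf.
have K_eta : K * (eta n / Num.sqrt n%:R) @[n --> \oo] --> (0 : R).
  by rewrite -[X in _ --> X](mulr0 K); apply: cvgM => //; exact: cvg_cst.
apply: (levy_continuity mZ) => //.
  move=> e e0.
  (* Chosen so that [V / L0^2 <= e]. Eventually [Z n] is within 1 of [ols_dev], hence the level
     [L0 + 1] below. *)
  pose L0 := Num.sqrt (V / e) + 1.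
  have L00 : 0 < L0 by rewrite ltr_pwDr// sqrtr_ge0.
  exists (L0 + 1); near=> n.
  have tn : forall L, 0 < L ->
    (P [set w | (L < `|ols_dev xs eps n w|)%R] <= (V / L ^+ 2)%:E)%E by near: n.
  apply: (@le_trans _ _ (P [set w | (L0 < `|ols_dev xs eps n w|)%R])).
    apply: le_measure; rewrite ?inE.
    - exact: measurable_norm_gt.
    - by apply: measurable_norm_gt; exact: measurable_ols_dev.
    move=> w /= Lw.
    have zw : `|Z n w - ols_dev xs eps n w| <= 1.
      apply: (@le_trans _ _ (K * (eta n / Num.sqrt n%:R))).
        have : forall w, `|Z n w - ols_dev xs eps n w| <= K * (eta n / Num.sqrt n%:R) by near: n.
        exact.
      apply: le_trans (ler_norm _) _; rewrite -normrN -sub0r.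
      by near: n; have /cvgrPdist_le/(_ _ ltr01) := K_eta.
    have := ler_normD (Z n w - ols_dev xs eps n w) (ols_dev xs eps n w).
    by rewrite subrK; lra.
  apply: le_trans (tn _ L00) _; rewrite lee_fin ler_pdivrMr ?exprn_gt0//.
  rewrite mulrC -ler_pdivrMr//.
  rewrite -[leLHS]sqr_sqrtr ?divr_ge0 ?(ltW e0)// lerXn2r ?nnegrE ?sqrtr_ge0 ?(ltW L00)//.
  by rewrite /L0 lerDl.
move=> t th; rewrite gauss_mean_cos AE -scalemxAl dotpZr dotpC.
have cf_ols : \int[P]_w cos (dotp t (ols_dev xs eps n w) + th) @[n --> \oo] -->
    expR (- (sigma ^+ 2 * dotp (invmx C *m t) t) / 2) * cos th.
  exact: (ols_dev_cf indep ident int0 mean0 var0 gramC kappa0 coer).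
(* Cosine is 1-Lipschitz, so the two means differ by at most [p |t|] times the deterministic
   distance, which now tends to 0. *)
suff d0 : \int[P]_w cos (dotp t (Z n w) + th) - \int[P]_w cos (dotp t (ols_dev xs eps n w) + th)
    @[n --> \oo] --> (0 : R).
  rewrite -[X in _ --> X]add0r.
  have -> : (fun n => \int[P]_w cos (dotp t (Z n w) + th)) =
      (fun n => (\int[P]_w cos (dotp t (Z n w) + th) -
         \int[P]_w cos (dotp t (ols_dev xs eps n w) + th)) +
         \int[P]_w cos (dotp t (ols_dev xs eps n w) + th)).
    by apply/funext => n; rewrite subrK.
  exact: cvgD.
have mcos (Y : T -> 'cV[R]_p) : coord_measurable Y ->
    measurable_fun setT (fun w => cos (dotp t (Y w) + th)).
  by move=> mY; apply: measurable_comp_affine; [exact: continuous_cos|exact: measurable_dotp].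
apply: norm_cvg0.
have up : p%:R * `|t| * (K * (eta n / Num.sqrt n%:R)) @[n --> \oo] --> (0 : R).
  by rewrite -[X in _ --> X](mulr0 (p%:R * `|t|)); apply: cvgM => //; exact: cvg_cst.
apply: (squeeze_cvgr _ (cvg_cst 0) up); near=> n.
rewrite normr_ge0/=.
have iZ := bounded_integrable P (mcos _ (mZ n)) (fun w => cos_max _).
have iO := bounded_integrable P (mcos _ (measurable_ols_dev xs eps n)) (fun w => cos_max _).
rewrite -(RintegralB measurableT iZ iO).
apply: mean_norm_le; first exact: measurable_funB (mcos _ (mZ n)) (mcos _ (measurable_ols_dev xs eps n)).
move=> w; apply: le_trans (cos_lip _ _) _.
rewrite opprD addrACA subrr addr0 -dotpBr.
apply: le_trans (dotp_norm _ _) _; rewrite ler_wpM2l ?mulr_ge0//.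
have : forall w, `|Z n w - ols_dev xs eps n w| <= K * (eta n / Num.sqrt n%:R) by near: n.
exact.
Unshelve. all: by end_near. Qed.
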